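(* Let $d,m,E\ge 1$ be integers, let $\mathcal{L}_{jk}:\mathbb{R}^d\to\mathbb{R}$ ($0\le j\le m-1$, $0\le k\le E-1$) be smooth functions, and put $\mathcal{L}_j=\frac1E\sum_{k=0}^{E-1}\mathcal{L}_{jk}$ and $\mathcal{L}=\frac1m\sum_{j=0}^{m-1}\mathcal{L}_j$. Fix an initial parameter $\omega^0\in\mathbb{R}^d$, and for a learning rate $\eta>0$ let $\omega^0,\omega^1,\omega^2,\dots$ be the (random) aggregated parameters at the starts of the successive rounds of SCAFFOLD with full client participation, ideal control variates, $E$ local steps and learning rate $\eta$. Define the modified loss $$\tilde{\mathcal{L}}_{SCAFFOLD}(\omega)=\mathcal{L}(\omega)+\frac{\eta}{4}\|\nabla\mathcal{L}(\omega)\|^2+\frac{\eta}{4mE}\sum_{j=0}^{m-1}\sum_{k=0}^{E-1}\|\nabla\mathcal{L}_j(\omega)-\nabla\mathcal{L}_{jk}(\omega)\|^2 .$$ Then the expectation of the discrete update of the aggregated parameter follows the gradient flow of $\tilde{\mathcal{L}}_{SCAFFOLD}$ up to an error $O(E^3\eta^3)$ per round. That is, for every round index $i\ge 1$ there exist $\eta_0>0$ and $C>0$ (depending on $i$, $m$, $E$, the functions $\mathcal{L}_{jk}$ and $\omega^0$, but not on $\eta$) such that for all $0<\eta\le\eta_0$ and all outcomes of the rounds $0,\dots,i-1$, the solution $\omega(\cdot)$ of $\dot\omega(t)=-\nabla\tilde{\mathcal{L}}_{SCAFFOLD}(\omega(t))$, $\omega(0)=\omega^i$, exists on $[0,E\eta]$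 and $$\big\|\mathbb{E}_i[\omega^{i+1}]-\omega(E\eta)\big\|\le C\,\eta^3 ,$$ where $\mathbb{E}_i$ denotes the expectation over the random mini-batch order of round $i$, conditional on the rounds $0,\dots,i-1$.
   Context: $\|\cdot\|$ is the Euclidean norm and $\nabla$ is the gradient with respect to $\omega$. SCAFFOLD with full participation and ideal control variates: rounds are indexed $i=0,1,2,\dots$, and round $i$ starts from the aggregated parameter $\omega^i$. In round $i$ client $j$ uses a client control variate $c_{ij}\in\mathbb{R}^d$ and all clients use the server control variate $c_i\in\mathbb{R}^d$. These are $c_{0j}=c_0=0$ for $i=0$, and for $i\ge1$ they are the exact gradients at the starting parameter of the previous round: $$c_{ij}=\nabla\mathcal{L}_j(\omega^{i-1}),\qquad c_i=\nabla\mathcal{L}(\omega^{i-1}).$$ For each round $i$ and each client $j$ a permutation $\pi_{ij}$ of $\{0,\dots,E-1\}$ is drawn uniformly at random, independently across rounds (the random order of the mini-batches). Client $j$ sets $\omega^{ij}_0=\omega^i$ and $$\omega^{ij}_{k+1}=\omega^{ij}_k-\eta\big(\nabla\mathcal{L}_{j\pi_{ij}(k)}(\omega^{ij}_k)-c_{ij}+c_i\big),\qquad k=0,\dots,E-1 .$$ The server then averages: $\omega^{i+1}=\frac1m\sum_{j=0}^{m-1}\omega^{ij}_E$. *)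

(* Defs.v *)
From HB Require Import structures.
From mathcomp Require Import all_boot all_order all_algebra all_fingroup.
From mathcomp Require Import all_classical all_reals all_analysis.

Set Implicit Arguments.
Unset Strict Implicit.
Unset Printing Implicit Defensive.

Import Order.TTheory GRing.Theory Num.Theory.
Import numFieldNormedType.Exports.

Local Open Scope classical_set_scope.
Local Open Scope ring_scope.

Section calculus.
Context {R : realType} {d : nat}.
Implicit Types (f F : 'rV[R]_d -> R) (w : R -> 'rV[R]_d).

(* The library norm on 'rV[R]_d is the sup norm; the two norms induce the same
   topology, so only quantitative statements need this one. *)
Definition enorm (v : 'rV[R]_d) : R := Num.sqrt (\sum_k v 0 k ^+ 2).

Definition grad f (x : 'rV[R]_d) : 'rV[R]_d := \row_k 'D_(delta_mx 0 k) f x.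

(* C^n: all iterated partial derivatives of order at most n exist everywhere
   and are continuous. *)
Fixpoint class_C (n : nat) f : Prop :=
  continuous f /\
  if n is n'.+1 then
    forall k : 'I_d,
      (forall x, derivable f x (delta_mx 0 k)) /\
      class_C n' ('D_(delta_mx 0 k) f)
  else True.

Definition smooth f : Prop := forall n, class_C n f.

(* w solves w' = - grad F(w), w(0) = x0 on [0, T]; continuity on [0, T] makes
   the equation hold at the endpoints as well, with one-sided derivatives, as
   soon as grad F is continuous. *)
Definition gradient_flow F (x0 : 'rV[R]_d) (T : R) w : Prop :=
  [/\ w 0 = x0,
      {within `[0, T], continuous w} &
      forall t, 0 < t < T -> is_derive t 1 w (- grad F (w t))].

End calculus.

(* One round's mini-batch orders: s j is the permutation of client j. *)
Notation round_order m E := {ffun 'I_m -> 'S_E}.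

Section scaffold.
Context {R : realType} {d m E : nat}.
Variable L : 'I_m -> 'I_E -> 'rV[R]_d -> R.

Definition client_loss (j : 'I_m) : 'rV[R]_d -> R :=
  fun x => E%:R^-1 * \sum_k L j k x.

Definition loss : 'rV[R]_d -> R :=
  fun x => m%:R^-1 * \sum_j client_loss j x.

Variable eta : R.

(* enum 'I_E lists 0, ..., E - 1 in increasing order, so the fold performs the
   E local steps in the order s 0, ..., s (E - 1). *)
Definition local_update (j : 'I_m) (s : 'S_E) (cj c x : 'rV[R]_d) : 'rV[R]_d :=
  foldl (fun v k => v - eta *: (grad (L j (s k)) v - cj + c)) x (enum 'I_E).

Definition scaffold_round (s : round_order m E) (cj : 'I_m -> 'rV[R]_d)
    (c x : 'rV[R]_d) : 'rV[R]_d :=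
  m%:R^-1 *: \sum_j local_update j (s j) (cj j) c x.

(* Aggregated parameter at the start of round i, when round k uses the orders
   s k; it depends on s only through rounds 0, ..., i - 1. *)
Fixpoint scaffold (x0 : 'rV[R]_d) (s : nat -> round_order m E) (i : nat) :
    'rV[R]_d :=
  if i is i'.+1 then
    let cj j :=
      if i' is i''.+1 then grad (client_loss j) (scaffold x0 s i'') else 0 in
    let c := if i' is i''.+1 then grad loss (scaffold x0 s i'') else 0 in
    scaffold_round (s i') cj c (scaffold x0 s i')
  else x0.

Definition modified_loss : 'rV[R]_d -> R := fun x =>
  loss x + eta / 4 * enorm (grad loss x) ^+ 2
  + eta / (4 * m%:R * E%:R) *
    \sum_j \sum_k enorm (grad (client_loss j) x - grad (L j k) x) ^+ 2.

End scaffold.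

Section randomness.
Context {R : realType} {disp : measure_display} {Omega : measurableType disp}.
Variable P : probability Omega R.

(* Each client's order in each round is uniform, and the rounds are mutually
   independent; the joint law of the clients' orders within one round is left
   unconstrained. *)
Record random_orders {m E : nat} (pi : nat -> Omega -> round_order m E) : Prop :=
  RandomOrders {
    orders_measurable : forall i s, measurable [set x | pi i x = s];
    orders_uniform : forall i j (s : 'S_E),
      P [set x | pi i x j = s] = ((E`!)%:R^-1)%:E;
    orders_independent :
      forall (I : seq nat) (A : nat -> set (round_order m E)), uniq I ->
        P [set x | forall i, i \in I -> A i (pi i x)] =
        (\prod_(i <- I) P [set x | A i (pi i x)])%E
  }.

(* The rounds before round i had the outcome h. *)
Definition past_event {m E : nat} (pi : nat -> Omega -> round_order m E)
    (h : nat -> round_order m E) (i : nat) : set Omega :=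
  [set x | forall k, (k < i)%N -> pi k x = h k].

(* Expectation of a random vector conditional on an event A, meaningful only
   when P A > 0. *)
Definition cond_expectation {d : nat} (A : set Omega)
    (X : Omega -> 'rV[R]_d) : 'rV[R]_d :=
  \row_k ((\int[P]_(x in A) X x 0 k) / fine (P A)).

End randomness.

(* Main.v *)
(* With sup norms throughout, every error term is bounded by C * eta ^+ n uniformly
   over a set of parameters (learning rate, past orders, flow, time).

   Expanding the E local steps of client j around x = omega^i up to O(eta ^ 3)
   gives a drift term and a second-order term, a sum over ordered pairs of
   mini-batches.  Reversing a permutation exchanges the two halves of the sum over
   pairs, so the average over permutations is half of (all pairs - diagonal); this
   needs only the marginal law of each client's order.  The control variates
   cancel from the averaged drift; in the second-order term they may be replaced
   by the gradients at x, because omega^i - omega^(i-1) = O(eta).  The solution of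
   the gradient flow has the same expansion: by symmetry of second derivatives,
   the gradient of |grad f|^2 / 2 is the Hessian of f applied to grad f. *)
Require Import Defs.
From mathcomp Require Import all_boot all_order all_algebra all_fingroup.
From mathcomp Require Import all_classical all_reals all_analysis.
From mathcomp Require Import ring lra.
Import Order.TTheory GRing.Theory Num.Theory.
Import numFieldNormedType.Exports.
Local Open Scope classical_set_scope.
Local Open Scope ring_scope.

(** * Functions of several variables *)

(** The constants may depend neither on the past orders nor on the probability space. The past
    orders are treated as parameters of a deterministic recursion, and the probability space
    disappears once the conditional expectation is replaced by a finite average over permutations.
    The gradients are only locally Lipschitz, so the flow could leave every bounded set. For
    [eta <= 1], however, every possible [omega^i] lies in one fixed ball, and bounds on a ball whose
    radius is larger by one decide how small [eta0] has to be: a solution then exists on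
    [[0, E eta]], and every solution stays within distance one of [omega^i]. Smoothness is expressed
    by partial derivatives alone, so the mean value theorem, Taylor's formula and the symmetry of
    second derivatives are obtained by moving along one coordinate at a time. *)

Section row_norm.
Context {R : realType} {d : nat}.
Implicit Types v : 'rV[R]_d.

Lemma coord_le_norm v k : `|v 0 k| <= `|v|.
Proof. by rewrite [leRHS]/Num.Def.normr/= mx_normrE; exact: (le_bigmax _ _ (0, k)). Qed.

Lemma row_norm_le v r : 0 <= r -> (forall k, `|v 0 k| <= r) -> `|v| <= r.
Proof.
move=> r0 vr; rewrite [leLHS]/Num.Def.normr/= mx_normrE; apply: bigmax_le => //.
by move=> [i k] _ /=; rewrite ord1.
Qed.

Lemma enorm_sqr v : enorm v ^+ 2 = \sum_k v 0 k ^+ 2.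
Proof. by rewrite sqr_sqrtr// sumr_ge0// => k _; exact: sqr_ge0. Qed.

(** The only passage from the sup norm to the Euclidean norm; the crude factor [d] comes from
    [d <= d ^ 2]. *)
Lemma enorm_le v r : 0 <= r -> (forall k, `|v 0 k| <= r) -> enorm v <= d%:R * r.
Proof.
move=> r0 vr; rewrite /enorm -[leRHS]ger0_norm ?mulr_ge0// -sqrtr_sqr ler_wsqrtr//.
apply: (@le_trans _ _ (\sum_(k < d) r ^+ 2)).
  by apply: ler_sum => k _; rewrite -real_normK ?num_real// lerXn2r ?nnegrE.
rewrite sumr_const card_ord -[leLHS]mulr_natl [leRHS]exprMn; apply: ler_wpM2r; first exact: sqr_ge0.
by rewrite -natrX ler_nat; case: (d) => // n; rewrite leq_pmulr.
Qed.
End row_norm.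

Section partial_derivatives.
Context {R : realType} {d : nat}.
Implicit Types (f g : 'rV[R]_d -> R) (x y : 'rV[R]_d) (k l : 'I_d).

Local Notation partial k f := ('D_(delta_mx 0 k) f).

Lemma is_derive_line f x k (t : R) : (forall z, derivable f z (delta_mx 0 k)) ->
  is_derive t 1 (fun s : R => f (x + s *: delta_mx 0 k))
    (partial k f (x + t *: delta_mx 0 k)).
Proof.
move=> df.
have E : (fun h : R => h^-1 *: (((fun s : R => f (x + s *: delta_mx 0 k)) \o shift t)
           (h *: (1 : R)) - f (x + t *: delta_mx 0 k)))
  = (fun h : R => h^-1 *: ((f \o shift (x + t *: delta_mx 0 k)) (h *: delta_mx 0 k)
           - f (x + t *: delta_mx 0 k))).
  apply/funext => h /=; congr (_ *: (f _ - _)).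
  by rewrite scalerDl -[h%:A]/(h * 1) mulr1 addrCA.
split; first by rewrite /derivable E; exact: df.
by rewrite /derive E.
Qed.

(** The segment is parametrised by [s] in [[0, 1]], so that [c] may have either sign. *)
Lemma partial_MVT f x k (c : R) : (forall z, derivable f z (delta_mx 0 k)) ->
  exists2 s : R, 0 <= s <= 1 &
    f (x + c *: delta_mx 0 k) - f x =
    partial k f (x + (s * c) *: delta_mx 0 k) * c.
Proof.
move=> df.
have D (t : R) : is_derive t 1 (fun s : R => f (x + (s * c) *: delta_mx 0 k))
    (partial k f (x + (t * c) *: delta_mx 0 k) * c).
  have dc : is_derive t 1 (fun s : R => s * c) c.
    have -> : (fun s : R => s * c) = c \*: (id : R -> R).
      by apply/funext => s /=; rewrite mulrC.
    by apply: is_derive_eq; rewrite -[c%:A]/(c * 1) mulr1.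
  have dl := is_derive_line f x k (t * c) df.
  have := @is_derive1_comp R (fun s : R => f (x + s *: delta_mx 0 k))
    (fun s : R => s * c) t _ _ dl dc.
  by move=> H; apply: is_derive_eq; rewrite mulrC.
have [s s01 E] := @MVT_segment R (fun s : R => f (x + (s * c) *: delta_mx 0 k))
  (fun t => partial k f (x + (t * c) *: delta_mx 0 k) * c) 0 1 ler01
  (fun t _ => D t) (derivable_within_continuous (fun t _ => @ex_derive _ _ _ _ _ _ _ (D t))).
exists s; first by move: s01; rewrite in_itv.
by move: E; rewrite mul1r mul0r scale0r addr0 subr0 mulr1.
Qed.

(** Vertices of a path from [x] to [y] that changes one coordinate at a time, since only derivatives
    along the axes are available. *)
Let corner x y n : 'rV[R]_d := \row_k (if (k < n)%N then y 0 k else x 0 k).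

(** Telescoping over the vertices of the path. Each [xi k] lies on an edge of the box spanned by [x]
    and [y], hence between them in every coordinate; in the sup norm this gives the first two
    clauses. *)
Lemma mean_value f x y : (forall k z, derivable f z (delta_mx 0 k)) ->
  exists xi : 'I_d -> 'rV[R]_d,
    [/\ forall k r, `|x| <= r -> `|y| <= r -> `|xi k| <= r,
        forall k, `|xi k - x| <= `|y - x| &
        f y - f x = \sum_k partial k f (xi k) * (y 0 k - x 0 k)].
Proof.
move=> df.
have step k : corner x y k.+1 = corner x y k + (y 0 k - x 0 k) *: delta_mx 0 k.
  apply/rowP => l; rewrite !mxE ltnS leq_eqVlt eqxx /=.
  have [->|lk] := eqVneq l k; first by rewrite eqxx ltnn mulr1 addrC subrK.
  by rewrite (negbTE (lk : (l : nat) != k)) mulr0 addr0.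
have /(_ _)/cid2 H k := partial_MVT f (corner x y k) k (y 0 k - x 0 k) (df k).
pose s k := s2val (H k).
exists (fun k => corner x y k + (s k * (y 0 k - x 0 k)) *: delta_mx 0 k).
have s01 k : 0 <= s k <= 1 by rewrite /s; case: (H k).
have conv (k l : 'I_d) : exists2 c : R, 0 <= c <= 1 &
    (corner x y k + (s k * (y 0 k - x 0 k)) *: delta_mx 0 k) 0 l =
    x 0 l + c * (y 0 l - x 0 l).
  rewrite !mxE eqxx /=; have [->|lk] := eqVneq l k.
    by rewrite ltnn; exists (s k) => //; rewrite mulr1.
  rewrite mulr0 addr0; case: ltnP => _; [exists 1|exists 0].
  - by rewrite ler01 lexx.
  - by rewrite mul1r addrC subrK.
  - by rewrite ler01 lexx.
  - by rewrite mul0r addr0.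
split.
- move=> k r xr yr; apply: row_norm_le => [|l]; first exact: le_trans xr.
  have [c /andP[c0 c1] ->] := conv k l.
  have -> : x 0 l + c * (y 0 l - x 0 l) = (1 - c) * x 0 l + c * y 0 l by ring.
  apply: (le_trans (ler_normD _ _)); rewrite !normrM.
  rewrite (ger0_norm c0) ger0_norm ?subr_ge0//.
  have -> : r = (1 - c) * r + c * r by ring.
  apply: lerD; apply: ler_wpM2l; rewrite ?subr_ge0//.
    by apply: le_trans xr; exact: coord_le_norm.
  by apply: le_trans yr; exact: coord_le_norm.
- move=> k; apply: row_norm_le => [//|l]; rewrite mxE [X in _ + X]mxE.
  have [c /andP[c0 c1] ->] := conv k l; rewrite addrC addKr normrM ger0_norm//.
  apply: (le_trans (ler_piMl _ c1)) => //.
  by have := coord_le_norm (y - x) l; rewrite !mxE.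
- have -> : \sum_k partial k f (corner x y k + (s k * (y 0 k - x 0 k)) *: delta_mx 0 k)
            * (y 0 k - x 0 k)
          = \sum_(k < d) (f (corner x y k.+1) - f (corner x y k)).
    apply: eq_bigr => k _; rewrite step; apply/esym.
    by rewrite /s; case: (H k).
  rewrite -(big_mkord xpredT (fun k : nat => f (corner x y k.+1) - f (corner x y k))).
  rewrite telescope_sumr//; congr (f _ - f _); apply/rowP => l; rewrite !mxE.
    by rewrite ltn_ord.
  by rewrite ltn0.
Qed.

End partial_derivatives.

(** * Smooth functions: algebra, local bounds, Taylor's formula, symmetry of second derivatives *)

Section smooth_functions.
Context {R : realType} {d : nat}.
Implicit Types (f g : 'rV[R]_d -> R) (x y : 'rV[R]_d) (k l : 'I_d).

Local Notation partial k f := ('D_(delta_mx 0 k) f).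

Lemma class_CS n f : class_C n.+1 f -> class_C n f.
Proof.
elim: n f => [|n IH] f [cf df]; split => // k; have [fk dfk] := df k.
by split => //; exact: IH.
Qed.

Lemma class_C_cst n (c : R) : class_C n (cst c : 'rV[R]_d -> R).
Proof.
elim: n c => [|n IH] c; split => //; try exact: cst_continuous.
move=> k; split; first by move=> x; exact: derivable_cst.
have -> : partial k (cst c : 'rV[R]_d -> R) = cst 0.
  by apply/funext => x; rewrite derive_cst.
exact: IH.
Qed.

Lemma class_CD n f g : class_C n f -> class_C n g -> class_C n (f + g).
Proof.
elim: n f g => [|n IH] f g [cf df] [cg dg].
  by split => // x; exact: (continuousD (cf x) (cg x)).
split=> [x|k]; first exact: (continuousD (cf x) (cg x)).
have [[fk dfk] [gk dgk]] := (df k, dg k).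
split; first by move=> x; exact: derivableD.
have -> : partial k (f + g) = partial k f + partial k g.
  by apply/funext => x; rewrite deriveD.
exact: IH.
Qed.

Lemma class_CM n f g : class_C n f -> class_C n g -> class_C n (f * g).
Proof.
elim: n f g => [|n IH] f g Cf Cg; have [[cf df] [cg dg]] := (Cf, Cg).
  by split => // x; exact: (continuousM (cf x) (cg x)).
split=> [x|k]; first exact: (continuousM (cf x) (cg x)).
have [[fk dfk] [gk dgk]] := (df k, dg k).
split; first by move=> x; exact: derivableM.
have -> : partial k (f * g) = f * partial k g + g * partial k f.
  by apply/funext => x; rewrite deriveM.
by apply: class_CD; apply: IH => //; exact: class_CS.
Qed.

Lemma smooth_cst (c : R) : smooth (cst c : 'rV[R]_d -> R).
Proof. by move=> n; exact: class_C_cst. Qed.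

Lemma smoothD f g : smooth f -> smooth g -> smooth (f + g).
Proof. by move=> sf sg n; exact: class_CD. Qed.

Lemma smoothM f g : smooth f -> smooth g -> smooth (f * g).
Proof. by move=> sf sg n; exact: class_CM. Qed.

Lemma smoothZ (c : R) f : smooth f -> smooth (c *: f).
Proof. exact: (smoothM _ _ (smooth_cst c)). Qed.

Lemma smoothB f g : smooth f -> smooth g -> smooth (f - g).
Proof. by move=> sf sg; rewrite -scaleN1r; apply: smoothD => //; exact: smoothZ. Qed.

Lemma smooth_sum (I : finType) (F : I -> 'rV[R]_d -> R) :
  (forall i, smooth (F i)) -> smooth (\sum_i F i).
Proof.
move=> sF; elim/big_ind: _ => //; [exact: smooth_cst|exact: smoothD].
Qed.

Lemma smooth_continuous f : smooth f -> continuous f.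
Proof. by move=> /(_ 0%N)[]. Qed.

Lemma smooth_derivable f k x : smooth f -> derivable f x (delta_mx 0 k).
Proof. by move=> /(_ 1%N)[_ /(_ k)[]]. Qed.

Lemma smooth_partial f k : smooth f -> smooth (partial k f).
Proof. by move=> sf n; have [_ /(_ k)[]] := sf n.+1. Qed.

Lemma partialD f g k : smooth f -> smooth g ->
  partial k (f + g) = partial k f + partial k g.
Proof.
by move=> sf sg; apply/funext => x; rewrite deriveD//; exact: smooth_derivable.
Qed.

Lemma partialM f g k : smooth f -> smooth g ->
  partial k (f * g) = f * partial k g + g * partial k f.
Proof.
by move=> sf sg; apply/funext => x; rewrite deriveM//; exact: smooth_derivable.
Qed.

Lemma partialZ (c : R) f k : smooth f -> partial k (c *: f) = c *: partial k f.
Proof.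
by move=> sf; apply/funext => x; rewrite deriveZ//; exact: smooth_derivable.
Qed.

Lemma partialB f g k : smooth f -> smooth g ->
  partial k (f - g) = partial k f - partial k g.
Proof.
by move=> sf sg; apply/funext => x; rewrite deriveB//; exact: smooth_derivable.
Qed.

Lemma partial_sum (I : finType) (F : I -> 'rV[R]_d -> R) k :
  (forall i, smooth (F i)) -> partial k (\sum_i F i) = \sum_i partial k (F i).
Proof.
(* Smoothness of the partial sums is carried along, because [partialD] asks for it. *)
move=> sF; suff [] : smooth (\sum_i F i) /\
  partial k (\sum_i F i) = \sum_i partial k (F i) by [].
elim/big_ind2 : _ => [|f1 g1 f2 g2 [s1 e1] [s2 e2]|i _].
- by split; [exact: smooth_cst|apply/funext => x; exact: derive_cst].
- by split; [exact: smoothD|rewrite partialD// e1 e2].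
- by split.
Qed.

Definition loc_bounded f := forall r : R, exists2 K : R, 0 <= K &
  forall x, `|x| <= r -> `|f x| <= K.

Definition loc_lipschitz f := forall r : R, exists2 K : R, 0 <= K &
  forall x y, `|x| <= r -> `|y| <= r -> `|f y - f x| <= K * `|y - x|.

Lemma closed_ball_compact (r : R) : compact [set x : 'rV[R]_d | `|x| <= r].
Proof.
apply: bounded_closed_compact.
  exists r; split; first exact: num_real.
  by move=> s rs x /= xr; apply: (le_trans xr); exact: ltW.
have -> : [set x : 'rV[R]_d | `|x| <= r] = (fun x => `|x|) @^-1` [set t | t <= r].
  by [].
apply: preimage_closed; last exact: closed_le.
by move=> x _; exact: norm_continuous.
Qed.

(** Extreme value theorem on the closed ball, which is compact in finite dimension; for [r < 0] the
    ball is empty. *)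
Lemma continuous_loc_bounded f : continuous f -> loc_bounded f.
Proof.
move=> cf r; have [r0|r0] := ltP r 0.
  by exists 0 => // x xr; have := lt_le_trans (le_lt_trans xr r0) (normr_ge0 x); rewrite ltxx.
have [|||c _ H] := @EVT_max_rV R d (fun x => `|f x|) [set x : 'rV[R]_d | `|x| <= r].
- by exists 0; rewrite /= normr0.
- exact: closed_ball_compact.
- apply: continuous_subspaceT => x; apply: continuous_comp; first exact: cf.
  exact: norm_continuous.
by exists `|f c| => // x xr; apply: H; rewrite inE.
Qed.

Lemma smooth_loc_bounded f : smooth f -> loc_bounded f.
Proof. by move=> /smooth_continuous/continuous_loc_bounded. Qed.

Lemma loc_bounded_fin (I : finType) (F : I -> 'rV[R]_d -> R) (r : R) :
  (forall i, loc_bounded (F i)) ->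
  exists2 K : R, 0 <= K & forall i x, `|x| <= r -> `|F i x| <= K.
Proof.
move=> /(_ _ r)/cid2 H; pose K i := s2val (H i).
have K0 i : 0 <= K i by rewrite /K; case: (H i).
exists (\sum_i K i); first exact: sumr_ge0.
move=> i x xr; apply: (@le_trans _ _ (K i)); first by rewrite /K; case: (H i) => /= ? _; apply.
by rewrite (bigD1 i)//= lerDl sumr_ge0.
Qed.

Lemma smooth_loc_lipschitz f : smooth f -> loc_lipschitz f.
Proof.
move=> sf r; have [|K K0 HK] := @loc_bounded_fin _ (fun k => partial k f) r.
  by move=> k; apply: smooth_loc_bounded; exact: smooth_partial.
exists (d%:R * K); first by rewrite mulr_ge0.
move=> x y xr yr; have [|xi [xir _ ->]] := mean_value f x y.
  by move=> k z; exact: smooth_derivable.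
apply: (le_trans (ler_norm_sum _ _ _)).
apply: (@le_trans _ _ (\sum_(k < d) K * `|y - x|)).
  apply: ler_sum => k _; rewrite normrM ler_pM//; first exact/HK/xir.
  by have := coord_le_norm (y - x) k; rewrite !mxE.
by rewrite sumr_const card_ord -[leLHS]mulr_natl mulrA.
Qed.

(** Replacing the partial derivatives at [xi k] in [mean_value] by those at [x] costs a Lipschitz
    constant times [|xi k - x| <= |y - x|], and each term carries one more factor bounded by
    [|y - x|]. *)
Lemma smooth_taylor f : smooth f -> forall r : R, exists2 K : R, 0 <= K &
  forall x y, `|x| <= r -> `|y| <= r ->
    `|f y - f x - \sum_k partial k f x * (y 0 k - x 0 k)| <= K * `|y - x| ^+ 2.
Proof.
move=> sf r.
have /(_ _)/cid2 H k := smooth_loc_lipschitz _ (smooth_partial f k sf) r.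
pose K k := s2val (H k).
have K0 k : 0 <= K k by rewrite /K; case: (H k).
exists (\sum_k K k); first exact: sumr_ge0.
move=> x y xr yr; have [|xi [xir xid ->]] := mean_value f x y.
  by move=> k z; exact: smooth_derivable.
rewrite -sumrB; apply: (le_trans (ler_norm_sum _ _ _)).
rewrite mulr_suml; apply: ler_sum => k _; rewrite -mulrBl normrM expr2 mulrA.
apply: ler_pM => //.
  apply: (@le_trans _ _ (K k * `|xi k - x|)); last exact: ler_wpM2l.
  by rewrite /K; case: (H k) => /= ? _; apply => //; exact: xir.
by have := coord_le_norm (y - x) k; rewrite !mxE.
Qed.

(** The mean value theorem is used twice, in direction [l] on the increment [psi] and then in
    direction [k] on [partial l f]. The point [z] is displaced by at most [h] in each of the two
    directions, and these add up when [k = l]. *)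
Lemma second_difference f x k l (h : R) : smooth f -> 0 < h ->
  exists2 z, `|z - x| <= h *+ 2 &
    f (x + h *: delta_mx 0 k + h *: delta_mx 0 l) - f (x + h *: delta_mx 0 l)
    - (f (x + h *: delta_mx 0 k) - f x) =
    partial k (partial l f) z * h ^+ 2.
Proof.
move=> sf h0.
pose psi (t : R) := f (x + h *: delta_mx 0 k + t *: delta_mx 0 l) - f (x + t *: delta_mx 0 l).
have D (t : R) : is_derive t 1 psi (partial l f (x + h *: delta_mx 0 k + t *: delta_mx 0 l)
    - partial l f (x + t *: delta_mx 0 l)).
  apply: (@is_deriveB _ _ _ (fun t : R => f (x + h *: delta_mx 0 k + t *: delta_mx 0 l))
     (fun t : R => f (x + t *: delta_mx 0 l)));
  by apply: is_derive_line => z; exact: smooth_derivable.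
have [t] := @MVT_segment R psi _ 0 h (ltW h0) (fun t _ => D t)
  (derivable_within_continuous (fun t _ => @ex_derive _ _ _ _ _ _ _ (D t))).
rewrite in_itv /= => /andP[t0 th].
rewrite {1 2}/psi !scale0r !addr0 subr0 => ->.
have [|s /andP[s0 s1]] := partial_MVT (partial l f) (x + t *: delta_mx 0 l) k h.
  by move=> z; apply: smooth_derivable; exact: smooth_partial.
move=> E; rewrite (addrAC x) E.
exists (x + t *: delta_mx 0 l + (s * h) *: delta_mx 0 k); last by rewrite expr2 mulrA.
rewrite [X in `|X|](_ : _ = t *: delta_mx 0 l + (s * h) *: delta_mx 0 k); last first.
  by rewrite -[x + _ + _]addrA [X in X - x]addrC addrK.
apply: row_norm_le => [|i]; first by rewrite mulrn_wge0// ltW.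
rewrite !mxE !eqxx /= mulr2n; apply: (le_trans (ler_normD _ _)); apply: lerD.
  by case: (i == l); rewrite ?mulr1 ?mulr0 ?normr0 ?(ltW h0)// ger0_norm.
case: (i == k); rewrite ?mulr1 ?mulr0 ?normr0 ?(ltW h0)//.
by rewrite ger0_norm ?mulr_ge0 ?(ltW h0)// ler_piMl// ltW.
Qed.

(** The second difference is symmetric in [k] and [l], so the two mixed derivatives agree at two
    points [z1] and [z2] close to [x]. Both are Lipschitz near [x], so their values at [x] differ by
    a multiple of [h]. *)
Lemma partial_comm f k l : smooth f -> partial k (partial l f) = partial l (partial k f).
Proof.
move=> sf; apply/funext => x.
have S2 a b : smooth (partial a (partial b f)) by do 2!apply: smooth_partial.
have [K1 K10 H1] := smooth_loc_lipschitz _ (S2 k l) (`|x| + 2).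
have [K2 K20 H2] := smooth_loc_lipschitz _ (S2 l k) (`|x| + 2).
have xr : `|x| <= `|x| + 2 by rewrite lerDl.
have zr z h : 0 < h -> h <= 1 -> `|z - x| <= h *+ 2 -> `|z| <= `|x| + 2.
  move=> h0 h1 zx; rewrite -[z](subrK x) addrC; apply: (le_trans (ler_normD _ _)).
  by rewrite lerD2l (le_trans zx)// lerMn2r h1.
apply/eqP; rewrite -subr_eq0 -normr_le0; apply/ler_addgt0Pr => e e0; rewrite add0r.
(* The bound 1 keeps [z1] and [z2] in the ball of radius [|x| + 2]; the other bound makes the total
   error at most [e], and its [+ 1] keeps the denominator positive. *)
pose h := Num.min 1 (e / ((K1 + K2 + 1) *+ 2)).
have K3 : 0 < (K1 + K2 + 1) *+ 2 by rewrite mulrn_wgt0// ltr_wpDl// addr_ge0.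
have h0 : 0 < h by rewrite lt_min ltr01 divr_gt0.
have h1 : h <= 1 by rewrite ge_min lexx.
have he : (K1 + K2) * (h *+ 2) <= e.
  have : h <= e / ((K1 + K2 + 1) *+ 2) by rewrite ge_min lexx orbT.
  rewrite ler_pdivlMr// => he; apply: le_trans he.
  rewrite -subr_ge0 (_ : _ - _ = h *+ 2); last by ring.
  by rewrite mulrn_wge0// ltW.
have [z1 z1x E1] := second_difference f x k l h sf h0.
have [z2 z2x E2] := second_difference f x l k h sf h0.
have : partial k (partial l f) z1 = partial l (partial k f) z2.
  apply: (mulIf (_ : h ^+ 2 != 0)); first by rewrite expf_neq0// gt_eqF.
  have swap (a b c u : R) : a - b - (c - u) = a - c - (b - u) by ring.
  have C : x + h *: delta_mx 0 l + h *: delta_mx 0 k = x + h *: delta_mx 0 k + h *: delta_mx 0 l.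
    exact: addrAC.
  apply: (etrans (esym E1)); apply: etrans E2; rewrite C; exact: swap.
have shift_eq (a b c u : R) : b = u -> a - c = u - c - (b - a) by move=> ->; ring.
move=> /shift_eq E; apply: le_trans he; rewrite mulrDl.
rewrite E [leRHS]addrC; apply: (le_trans (ler_normB _ _)); apply: lerD.
  by apply: le_trans (H2 _ _ xr (zr _ _ h0 h1 z2x)) _; rewrite ler_wpM2l.
by apply: le_trans (H1 _ _ xr (zr _ _ h0 h1 z1x)) _; rewrite ler_wpM2l.
Qed.

End smooth_functions.

(** * Gradient of the modified loss *)

Section modified_gradient.
Context {R : realType} {d m E : nat}.
Implicit Types (f g : 'rV[R]_d -> R) (x : 'rV[R]_d).

Local Notation partial k f := ('D_(delta_mx 0 k) f).

(** Component [p] of the Hessian of [f] applied to its gradient. The derivative in [p] is the inner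
    one, as in a Taylor expansion of component [p] of the gradient. *)
Definition hess_grad f (p : 'I_d) : 'rV[R]_d -> R :=
  \sum_l partial l (partial p f) * partial l f.

Lemma smooth_hess_grad f p : smooth f -> smooth (hess_grad f p).
Proof.
by move=> sf; apply: smooth_sum => l; apply: smoothM; do ?apply: smooth_partial.
Qed.

Lemma hess_gradE f p x :
  hess_grad f p x = \sum_l partial l (partial p f) x * partial l f x.
Proof. by rewrite /hess_grad fct_sumE. Qed.

Lemma sqr_gradE f :
  (fun x => enorm (grad f x) ^+ 2) = \sum_l partial l f * partial l f.
Proof.
apply/funext => x; rewrite enorm_sqr fct_sumE; apply: eq_bigr => l _.
by rewrite mxE expr2.
Qed.

Lemma smooth_sqr_grad f : smooth f -> smooth (fun x => enorm (grad f x) ^+ 2).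
Proof.
move=> sf; rewrite sqr_gradE.
by apply: smooth_sum => l; apply: smoothM; apply: smooth_partial.
Qed.

Lemma partial_sqr_grad f p : smooth f ->
  partial p (fun x => enorm (grad f x) ^+ 2) = 2 *: hess_grad f p.
Proof.
move=> sf; rewrite sqr_gradE partial_sum => [|l]; last first.
  by apply: smoothM; exact: smooth_partial.
rewrite scaler_sumr; apply: eq_bigr => l _.
rewrite (partialM _ _ _ (smooth_partial _ _ sf) (smooth_partial _ _ sf)).
have dbl (u v w : 'rV[R]_d -> R) : w = v -> u * w + u * w = 2 *: (v * u).
  move=> ->; apply/funext => x.
  by change (u x * v x + u x * v x = 2 * (v x * u x)); ring.
exact: (dbl _ _ _ (partial_comm f p l sf)).
Qed.

Lemma gradB f g x : smooth f -> smooth g -> grad f x - grad g x = grad (f - g) x.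
Proof.
move=> sf sg; apply/rowP => k; rewrite !mxE.
exact: (esym (congr1 (@^~ x) (partialB f g k sf sg))).
Qed.

Variable L : 'I_m -> 'I_E -> 'rV[R]_d -> R.
Hypothesis sL : forall j k, smooth (L j k).

Lemma client_lossE j : client_loss L j = E%:R^-1 *: \sum_k L j k.
Proof. by apply/funext => x; rewrite -[RHS]/(E%:R^-1 * (\sum_k L j k) x) fct_sumE. Qed.

Lemma lossE : loss L = m%:R^-1 *: \sum_j client_loss L j.
Proof. by apply/funext => x; rewrite -[RHS]/(m%:R^-1 * (\sum_j client_loss L j) x) fct_sumE. Qed.

Lemma smooth_client_loss j : smooth (client_loss L j).
Proof. by rewrite client_lossE; apply: smoothZ; exact: smooth_sum. Qed.

Lemma smooth_loss : smooth (loss L).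
Proof.
by rewrite lossE; apply: smoothZ; apply: smooth_sum; exact: smooth_client_loss.
Qed.

Lemma partial_client_loss j p :
  partial p (client_loss L j) = E%:R^-1 *: \sum_k partial p (L j k).
Proof.
rewrite client_lossE (partialZ _ _ _ (smooth_sum _ _ (sL j))).
by rewrite (partial_sum _ _ _ (sL j)).
Qed.

Lemma partial_loss p :
  partial p (loss L) = m%:R^-1 *: \sum_j partial p (client_loss L j).
Proof.
rewrite lossE (partialZ _ _ _ (smooth_sum _ _ smooth_client_loss)).
by rewrite (partial_sum _ _ _ smooth_client_loss).
Qed.

(** Component [p] of the gradient of the two penalty terms, divided by [eta]; differentiating the
    squares turns each 4 in a denominator into a 2. *)
Definition correction (p : 'I_d) : 'rV[R]_d -> R :=
  2^-1 *: hess_grad (loss L) p +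
  (2 * m%:R * E%:R)^-1 *: \sum_j \sum_k hess_grad (client_loss L j - L j k) p.

Let sdiff j k : smooth (client_loss L j - L j k).
Proof. by apply: smoothB => //; exact: smooth_client_loss. Qed.

Lemma smooth_correction p : smooth (correction p).
Proof.
apply: smoothD; apply: smoothZ; first exact/smooth_hess_grad/smooth_loss.
by do 2!apply: smooth_sum => ?; exact: smooth_hess_grad.
Qed.

Let modified_lossE eta : modified_loss L eta =
  loss L + (eta / 4) *: (fun x => enorm (grad (loss L) x) ^+ 2) +
  (eta / (4 * m%:R * E%:R)) *:
    \sum_j \sum_k (fun x => enorm (grad (client_loss L j - L j k) x) ^+ 2).
Proof.
apply/funext => x; rewrite /modified_loss /=; congr (_ + _ * _).
rewrite fct_sumE; apply: eq_bigr => j _; rewrite fct_sumE; apply: eq_bigr => k _.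
by rewrite gradB//; exact: smooth_client_loss.
Qed.

Lemma partial_modified_loss eta p :
  partial p (modified_loss L eta) = partial p (loss L) + eta *: correction p.
Proof.
pose N : 'rV[R]_d -> R := fun x => enorm (grad (loss L) x) ^+ 2.
pose G j k : 'rV[R]_d -> R := fun x => enorm (grad (client_loss L j - L j k) x) ^+ 2.
have -> : modified_loss L eta = loss L + (eta / 4) *: N +
  (eta / (4 * m%:R * E%:R)) *: \sum_j \sum_k G j k := modified_lossE eta.
have sN : smooth N := smooth_sqr_grad _ smooth_loss.
have sG j k : smooth (G j k) := smooth_sqr_grad _ (sdiff j k).
have pN : partial p N = 2 *: hess_grad (loss L) p := partial_sqr_grad _ p smooth_loss.
have pG j k : partial p (G j k) = 2 *: hess_grad (client_loss L j - L j k) p :=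
  partial_sqr_grad _ p (sdiff j k).
(* [N] and [G] become opaque: only their smoothness and their partial derivatives are used from here
   on. *)
move: N G sN sG pN pG => N G sN sG pN pG.
have sG1 j := smooth_sum _ _ (sG j).
have sG2 := smooth_sum _ _ sG1.
have sN1 := smoothZ (eta / 4) _ sN.
rewrite (partialD _ _ _ (smoothD _ _ smooth_loss sN1) (smoothZ _ _ sG2)).
rewrite (partialD _ _ _ smooth_loss sN1) (partialZ _ _ _ sN) (partialZ _ _ _ sG2).
rewrite pN (partial_sum _ _ _ sG1).
rewrite (eq_bigr _ (fun j _ => partial_sum _ _ p (sG j))).
rewrite (eq_bigr _ (fun j _ => eq_bigr _ (fun k _ => pG j k))).
rewrite -addrA; congr (_ + _); rewrite /correction scalerDr; congr (_ + _).
  by rewrite !scalerA; congr (_ *: _); field.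
rewrite -(eq_bigr _ (fun j _ => scaler_sumr _ _ _ _)) -scaler_sumr !scalerA.
congr (_ *: _); rewrite -!(mulrA _ m%:R) !invfM.
by move: (m%:R^-1 * E%:R^-1) => z; field.
Qed.

End modified_gradient.

(** * Differential equations *)

Section real_lemmas.
Context {R : realType}.
Implicit Types (f u : R -> R) (a b t : R).

Lemma MVT_bound f (f' : R -> R) a b (B : R) : a <= b ->
  {within `[a, b], continuous f} ->
  (forall t, a < t < b -> is_derive t 1 f (f' t)) ->
  (forall t, a < t < b -> `|f' t| <= B) ->
  `|f b - f a| <= B * (b - a).
Proof.
rewrite le_eqVlt => /predU1P[-> _ _ _|ab cf df f'B].
  by rewrite !subrr normr0 mulr0.
have df' t : t \in `]a, b[%R -> is_derive t 1 f (f' t) by rewrite in_itv; exact: df.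
have [c] := MVT ab df' cf.
rewrite in_itv => /f'B cB ->; rewrite normrM (@ger0_norm _ (b - a)).
  by rewrite ler_wpM2r// subr_ge0 ltW.
by rewrite subr_ge0 ltW.
Qed.

Lemma antiderivative u (T : R) : continuous u -> exists2 U : R -> R, U 0 = 0 &
  forall t, 0 <= t <= T -> is_derive t 1 U (u t).
Proof.
(* Integration starts at -1, so that 0 is an interior point and the derivative there is
   two-sided. *)
move=> cu; pose F (x : R) := \int[lebesgue_measure]_(t in `[(- 1), x]) u t.
exists (fun x => F x - F 0) => [|t /andP[t0 tT]]; first by rewrite subrr.
have t1 : -1 < t by rewrite (lt_le_trans _ t0)// ltrN10.
have int_u : lebesgue_measure.-integrable `[(- 1), (t + 1)] (EFin \o u).
  apply: continuous_compact_integrable; first exact: segment_compact.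
  exact: continuous_subspaceT.
have tt1 : t < t + 1 by rewrite ltrDl.
have [dF F'] := continuous_FTC1_closed tt1 int_u t1 (cu t).
have FD : is_derive t 1 F (u t) by split; [exact: dF|rewrite -derive1E; exact: F'].
have -> : (fun x => F x - F 0) = F - cst (F 0) by [].
by apply: is_derive_eq; rewrite subr0.
Qed.

(** The intervals with centre [u n] and radius [c n], the tail of the geometric series, are nested;
    the supremum of their left ends lies in all of them. *)
Lemma nested_limit (u : nat -> R) : (forall n, `|u n.+1 - u n| <= 2^-1 ^+ n) ->
  exists l, forall n, `|u n - l| <= 2 * 2^-1 ^+ n.
Proof.
move=> du; pose c (n : nat) : R := 2 * 2^-1 ^+ n.
have cS n : c n.+1 + 2^-1 ^+ n = c n by rewrite /c exprS; field.
have c0 n : 0 <= c n by rewrite mulr_ge0// exprn_ge0// invr_ge0.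
have up n k : u n - c n <= u (n + k)%N - c (n + k)%N.
  elim: k => [|k IH]; first by rewrite addn0.
  rewrite addnS (le_trans IH)//; have := du (n + k)%N; rewrite -(cS (n + k)%N) ler_distl.
  by move=> /andP[+ _]; lra.
have dn n k : u (n + k)%N + c (n + k)%N <= u n + c n.
  elim: k => [|k IH]; first by rewrite addn0.
  rewrite addnS (le_trans _ IH)//; have := du (n + k)%N; rewrite -(cS (n + k)%N) ler_distl.
  by move=> /andP[_ +]; lra.
pose B := [set x | exists n, x = u n - c n].
have uB n : ubound B (u n + c n).
  move=> _ [k ->]; apply: (le_trans (up k n)); rewrite addnC.
  apply: le_trans (dn n k); have := c0 (n + k)%N; lra.
exists (sup B) => n; rewrite distrC ler_distl.
apply/andP; split; last by apply: ge_sup => //; exists (u 0%N - c 0%N), 0%N.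
by apply: ub_le_sup; [exists (u 0%N + c 0%N); exact: uB|exists n].
Qed.

(** Carries estimates on the Picard iterates over to their limit. *)
Lemma le_of_geometric (a b c : R) :
  (forall n : nat, a <= b + c * 2^-1 ^+ n) -> a <= b.
Proof.
move=> H; apply/ler_addgt0Pr => e e0.
have [n _ nc] : exists2 n : nat, True & `|c| / e < n%:R.
  exists (Num.bound (`|c| / e)) => //; apply: archi_boundP.
  by rewrite divr_ge0// ltW.
apply: (le_trans (H n)); rewrite lerD2l.
apply: (@le_trans _ _ (`|c| * 2^-1 ^+ n)).
  by rewrite ler_wpM2r ?ler_norm// exprn_ge0// invr_ge0.
rewrite exprVn ler_pdivrMr ?exprn_gt0// -ler_pdivrMl// mulrC.
apply: (le_trans (ltW nc)); rewrite -natrX ler_nat ltnW//.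
exact: ltn_expl.
Qed.

End real_lemmas.

Section ode.
Context {R : realType} {d : nat}.
Implicit Types (w : R -> 'rV[R]_d) (x y : 'rV[R]_d).

Lemma is_derive_coord w (t : R) (v : 'rV[R]_d) p : is_derive t 1 w v ->
  is_derive t 1 (fun s => w s 0 p) (v 0 p).
Proof.
move=> [dw wv]; have H := (derivable_mxP w t 1).1 dw; split; first exact: H.
by rewrite -wv derive_mx// mxE.
Qed.

Lemma is_derive_row w (t : R) (v : 'rV[R]_d) :
  (forall p, is_derive t 1 (fun s => w s 0 p) (v 0 p)) ->
  is_derive t 1 w v.
Proof.
move=> H; have dw : derivable w t 1.
  by apply/derivable_mxP => i p; rewrite ord1; case: (H p).
split => //; rewrite derive_mx//; apply/rowP => p; rewrite mxE.
by case: (H p).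
Qed.

Lemma continuous_coord w p (A : set R) :
  {within A, continuous w} -> {within A, continuous (fun s => w s 0 p)}.
Proof.
move=> cw t.
have H := @continuous_comp (subspace A) _ _ w (fun v : 'rV[R]_d => v 0 p) t (cw t).
by apply: H; exact: coord_continuous.
Qed.

(** Coordinatewise; thanks to the sup norm no factor depending on the dimension appears. *)
Lemma MVT_bound_row w (w' : R -> 'rV[R]_d) a b (B : R) : a <= b -> 0 <= B ->
  {within `[a, b], continuous w} ->
  (forall t, a < t < b -> is_derive t 1 w (w' t)) ->
  (forall t, a < t < b -> `|w' t| <= B) ->
  `|w b - w a| <= B * (b - a).
Proof.
move=> ab B0 cw dw wB; apply: row_norm_le; first by rewrite mulr_ge0// subr_ge0.
move=> p; rewrite !mxE.
apply: (@MVT_bound _ (fun s => w s 0 p) (fun s => w' s 0 p)) => //.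
- exact: continuous_coord.
- by move=> t /dw /is_derive_coord.
- by move=> t /wB; apply: le_trans; exact: coord_le_norm.
Qed.

Lemma antiderivative_row (u : R -> 'rV[R]_d) (T : R) : continuous u ->
  exists2 U : R -> 'rV[R]_d, U 0 = 0 &
  forall t, 0 <= t <= T -> is_derive t 1 U (u t).
Proof.
move=> cu.
have /(_ _)/cid2 H p : exists2 U : R -> R, U 0 = 0 &
    forall t, 0 <= t <= T -> is_derive t 1 U (u t 0 p).
  apply: antiderivative => t.
  apply: (@continuous_comp _ _ _ u (fun v : 'rV[R]_d => v 0 p)); first exact: cu.
  exact: coord_continuous.
exists (fun t => \row_p s2val (H p) t).
  by apply/rowP => p; rewrite !mxE; case: (H p).
move=> t tT; apply: is_derive_row => p.
have -> : (fun s => (\row_p0 s2val (H p0) s) 0 p) = s2val (H p).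
  by apply/funext => s; rewrite mxE.
by case: (H p) => /= U _; exact.
Qed.

Lemma lipschitz_continuous w (M : R) :
  (forall s t, `|w s - w t| <= M * `|s - t|) -> continuous w.
Proof.
move=> wM t; apply/cvgrPdist_le => e e0.
have M1 : 0 < `|M| + 1 by rewrite ltr_wpDl.
have tt : (fun s : R => s) @ t --> t by exact: cvg_id.
have H : \forall s \near t, `|t - s| <= e / (`|M| + 1).
  by have /cvgrPdist_le/(_ _ (divr_gt0 e0 M1)) := tt.
near=> s; apply: (le_trans (wM _ _)).
apply: (@le_trans _ _ ((`|M| + 1) * `|t - s|)).
  by rewrite ler_wpM2r// (le_trans (ler_norm _))// lerDl.
by rewrite -ler_pdivlMl// mulrC; near: s; exact: H.
Unshelve. all: by end_near. Qed.

(** * Local existence by Picard iteration *)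

Section picard.
Variables (G : 'rV[R]_d -> 'rV[R]_d) (x : 'rV[R]_d) (K M T : R).
Hypothesis T0 : 0 < T.
Hypothesis G_cont : continuous G.
Hypothesis G_le : forall y, `|y - x| <= 1 -> `|G y| <= M.
Hypothesis G_lip : forall y z, `|y - x| <= 1 -> `|z - x| <= 1 ->
  `|G y - G z| <= K * `|y - z|.
Hypothesis TM : T * M <= 1.
Hypothesis TK : T * K <= 2^-1.

(** Freezing time outside [[0, T]] makes every iterate continuous on the whole line, as
    [antiderivative_row] requires of its integrand. *)
Let clamp (t : R) := Num.max 0 (Num.min t T).

Let clamp_itv t : 0 <= clamp t <= T.
Proof. by rewrite /clamp le_max lexx /= ge_max ltW//= ge_min lexx orbT. Qed.

Let clamp_id t : 0 <= t <= T -> clamp t = t.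
Proof. by move=> /andP[t0 tT]; rewrite /clamp min_l// max_r. Qed.

Let clamp_lip s t : `|clamp s - clamp t| <= `|s - t|.
Proof.
wlog st : s t / s <= t.
  by move=> H; have [/H//|/ltW/H] := leP s t; rewrite distrC [leRHS]distrC.
have cst : clamp s <= clamp t.
  rewrite ge_max le_max lexx /= le_max; apply/orP; right.
  by rewrite le_min !ge_min st lexx orbT.
rewrite distrC ger0_norm ?subr_ge0// distrC ger0_norm ?subr_ge0//.
rewrite /clamp; case: (leP s T) => sT; case: (leP t T) => tT;
  rewrite ?(max_r (ltW T0)); case: (leP 0 s) => s0; case: (leP 0 t) => t0; lra.
Qed.

Let M0 : 0 <= M.
Proof. by apply: le_trans (G_le x _) => //; rewrite subrr normr0. Qed.

(** The first clause keeps [w] where the bounds on [G] hold; the second gives continuity and, unlike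
    continuity itself, passes to pointwise limits. *)
Let good w := (forall t, `|w t - x| <= 1) /\ (forall s t, `|w s - w t| <= M * `|s - t|).

(* w' is the Picard iterate of w, made constant in time outside [0, T]. *)
Let next w w' := exists U : R -> 'rV[R]_d, [/\ U 0 = 0,
  forall t, 0 <= t <= T -> is_derive t 1 U (G (w t)) &
  forall t, w' t = x + U (clamp t)].

Let U_cont (U u : R -> 'rV[R]_d) a b : (forall t, 0 <= t <= T -> is_derive t 1 U (u t)) ->
  0 <= a -> b <= T -> {within `[a, b], continuous U}.
Proof.
move=> dU a0 bT; apply: derivable_within_continuous => t.
rewrite in_itv /= => /andP[ta tb].
by have [] : is_derive t 1 U (u t) by apply: dU; rewrite (le_trans a0)//= (le_trans tb).
Qed.

(** [T * M <= 1] prevents the iterate from leaving the unit ball around [x]. *)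
Let next_good w : good w -> exists2 w', good w' & next w w'.
Proof.
move=> [wx wM].
have cGw : continuous (G \o w).
  move=> t; apply: continuous_comp; last exact: G_cont.
  exact: (lipschitz_continuous _ _ wM).
have [U U0 dU] := antiderivative_row _ T cGw.
have UM a b : 0 <= a -> a <= b -> b <= T -> `|U b - U a| <= M * (b - a).
  move=> a0 ab bT; apply: (@MVT_bound_row _ (G \o w)) => //.
  - exact: (U_cont _ _ _ _ dU).
  - by move=> t /andP[ta tb]; apply: dU; rewrite !ltW// ?(le_lt_trans a0)// (lt_le_trans tb).
  - by move=> t _; exact: G_le.
exists (fun t => x + U (clamp t)); last by exists U.
split=> [t|s t].
  have /andP[c0 cT] := clamp_itv t.
  rewrite addrC addKr -[U _]subr0 -U0; apply: (le_trans (UM _ _ (lexx _) c0 cT)).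
  by rewrite subr0; apply: le_trans TM; rewrite mulrC ler_wpM2r.
rewrite opprD addrACA subrr add0r; apply: (le_trans _ (ler_wpM2l M0 (clamp_lip s t))).
have /andP[cs0 csT] := clamp_itv s; have /andP[ct0 ctT] := clamp_itv t.
have [st|/ltW st] := leP (clamp s) (clamp t).
  by rewrite distrC (distrC (clamp s)) (@ger0_norm _ (_ - _)) ?subr_ge0//; exact: UM.
by rewrite (@ger0_norm _ (_ - _)) ?subr_ge0//; exact: UM.
Qed.

(** The factor comes from [T * K <= 2^-1]; [Num.max 0 K] provides the nonnegative bound that
    [MVT_bound_row] asks for. *)
Let next_contract w1 w2 v1 v2 (e : R) : good w1 -> good w2 -> next w1 v1 -> next w2 v2 ->
  0 <= e -> (forall t, `|w1 t - w2 t| <= e) -> forall t, `|v1 t - v2 t| <= 2^-1 * e.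
Proof.
move=> [w1x _] [w2x _] [U1 [U10 dU1 v1E]] [U2 [U20 dU2 v2E]] e0 we t.
rewrite v1E v2E opprD addrACA subrr add0r.
have /andP[c0 cT] := clamp_itv t.
have lip s : `|G (w1 s) - G (w2 s)| <= Num.max 0 K * e.
  apply: (le_trans (G_lip _ _ (w1x s) (w2x s))).
  apply: (@le_trans _ _ (Num.max 0 K * `|w1 s - w2 s|)).
    by rewrite ler_wpM2r// le_max lexx orbT.
  by rewrite ler_wpM2l// le_max lexx.
have D s : 0 <= s <= T -> is_derive s 1 (U1 - U2) (G (w1 s) - G (w2 s)).
  by move=> sT; apply: is_deriveB; [exact: dU1|exact: dU2].
have := @MVT_bound_row (U1 - U2) (fun s => G (w1 s) - G (w2 s)) 0 (clamp t)
  (Num.max 0 K * e) c0.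
rewrite -[(U1 - U2) 0]/(U1 0 - U2 0) U10 U20 subrr subr0 subr0.
move=> H; apply: (le_trans (H _ _ _ _)).
- by rewrite mulr_ge0// le_max lexx.
- exact: (U_cont _ _ _ _ D).
- by move=> s /andP[s0 sc]; apply: D; rewrite !ltW// (lt_le_trans sc).
- by move=> s _; exact: lip.
rewrite mulrAC ler_wpM2r// mulrC.
apply: (@le_trans _ _ (T * Num.max 0 K)); first by rewrite ler_wpM2r// le_max lexx.
by case: (leP 0 K) => // _; rewrite mulr0 invr_ge0.
Qed.

(** Starting from the constant [x], the first step has size at most 1 by [good] and each further one
    is halved, so the iterates converge geometrically. The limit [v] is again [good], hence has an
    iterate [v'] of its own, and contraction forces [v' = v]. *)
Lemma picard : exists w : R -> 'rV[R]_d, [/\ w 0 = x, continuous w &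
  forall t, 0 < t < T -> is_derive t 1 w (G (w t))].
Proof.
have /(_ _ _)/cid2 H : forall w, good w -> exists2 w', good w' & next w w' := next_good.
pose step (w : {w | good w}) : {w | good w} :=
  exist _ (s2val (H (sval w) (svalP w))) (s2valP (H (sval w) (svalP w))).
have stepP q : next (sval q) (sval (step q)) by exact: s2valP'.
have g0 : good (cst x) by split=> [t|s t]; rewrite subrr normr0// mulr_ge0.
pose w n := sval (iter n step (exist _ (cst x) g0)).
have gw n : good (w n) := svalP _.
have nw n : next (w n) (w n.+1) := stepP _.
have dw n t : `|w n.+1 t - w n t| <= 2^-1 ^+ n.
  elim: n t => [|n IH] t; first by rewrite expr0 {2}/w /=; case: (gw 1%N).
  by rewrite exprS; apply: (next_contract _ _ _ _ _ _ _ (nw n.+1) (nw n)) => //;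
    rewrite exprn_ge0// invr_ge0.
have /(_ _ _)/cid lim (t : R) p :
    exists l, forall n, `|w n t 0 p - l| <= 2 * 2^-1 ^+ n.
  apply: nested_limit => n; apply: le_trans (dw n t).
  by have := coord_le_norm (w n.+1 t - w n t) p; rewrite !mxE.
pose v t := \row_p sval (lim t p).
have vw n t : `|w n t - v t| <= 2 * 2^-1 ^+ n.
  apply: row_norm_le => [|p]; first by rewrite mulr_ge0// exprn_ge0// invr_ge0.
  by rewrite !mxE; exact: svalP (lim t p) n.
have gv : good v.
  split=> [t|s t].
    apply: (@le_of_geometric _ _ _ 2) => n.
    have -> : v t - x = (w n t - x) - (w n t - v t) by rewrite opprB [RHS]addrC addrA subrK.
    by apply: (le_trans (ler_normB _ _)); apply: lerD; [case: (gw n)|exact: vw].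
  apply: (@le_of_geometric _ _ _ 4) => n.
  have -> : v s - v t = (w n s - w n t) - (w n s - v s) + (w n t - v t).
    by apply/rowP => p; rewrite !mxE; ring.
  apply: (le_trans (ler_normD _ _)).
  have -> : 4 * 2^-1 ^+ n = 2 * 2^-1 ^+ n + 2 * 2^-1 ^+ n :> R by ring.
  rewrite addrA; apply: lerD; last exact: vw.
  apply: (le_trans (ler_normB _ _)); apply: lerD; last exact: vw.
  by case: (gw n) => _; exact.
have [v' gv' nv'] := next_good _ gv.
have vv' t : v' t = v t.
  apply/eqP; rewrite -subr_eq0 -normr_le0; apply: (@le_of_geometric _ _ _ 2) => n.
  rewrite add0r.
  have -> : v' t - v t = (w n.+1 t - v t) - (w n.+1 t - v' t).
    by rewrite opprB [RHS]addrC addrA subrK.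
  apply: (le_trans (ler_normB _ _)).
  have -> : 2 * 2^-1 ^+ n = 2 * 2^-1 ^+ n.+1 + 2^-1 * (2 * 2^-1 ^+ n) :> R by rewrite exprS; field.
  apply: lerD; first exact: vw.
  by apply: (next_contract _ _ _ _ _ _ _ (nw n) nv') => //; rewrite mulr_ge0// exprn_ge0// invr_ge0.
have [U [U0 dU v'E]] := nv'.
exists v; split.
- by rewrite -vv' v'E clamp_id ?lexx ?ltW// U0 addr0.
- by apply: lipschitz_continuous; case: gv => _; exact.
- move=> t /andP[t0 tT].
  have itv : t \in `]0, T[ by rewrite in_itv /= t0.
  (* Near an interior time [clamp] is the identity, so [v] is locally [x + U]. *)
  have E : \forall s \near t, (cst x + U) s = v s.
    apply: filterS (near_in_itvoo itv) => s; rewrite in_itv /= => /andP[s0 sT].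
    by rewrite -vv' v'E clamp_id// !ltW.
  have dUt : is_derive t 1 U (G (v t)) by apply: dU; rewrite !ltW.
  have dxU := is_deriveD (is_derive_cst x t 1) dUt; rewrite add0r in dxU.
  exact: near_eq_is_derive E dxU.
Qed.

End picard.

(** Holds for every solution, not only for the one built by [picard]. Let [i] be the infimum of the
    times at which [w] is outside the unit ball around [x]. Up to [i] the bound on [G] applies, so
    [|w i - x| <= M * i < 1]; by continuity [w] stays in the ball a little longer, which contradicts
    the choice of [i]. *)
Lemma ode_solution_bound (G : 'rV[R]_d -> 'rV[R]_d) x (M T : R) w : 0 <= M ->
  (forall y, `|y - x| <= 1 -> `|G y| <= M) -> T * M < 1 ->
  w 0 = x -> {within `[0, T], continuous w} ->
  (forall t, 0 < t < T -> is_derive t 1 w (G (w t))) ->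
  forall t, 0 <= t <= T -> `|w t - x| <= M * t.
Proof.
move=> M0 GM TM w0 cw dw.
have bound t : 0 <= t <= T -> (forall s, 0 <= s < t -> `|w s - x| <= 1) ->
    `|w t - x| <= M * t.
  move=> /andP[t0 tT] ws; rewrite -w0 -[X in M * X]subr0.
  apply: (@MVT_bound_row w (fun s => G (w s))) => //.
  - by apply: continuous_subspaceW cw => s /=; rewrite !in_itv /= => /andP[-> /le_trans]; apply.
  - by move=> s /andP[s0 st]; apply: dw; rewrite s0 (lt_le_trans st).
  - by move=> s /andP[s0 st]; apply: GM; apply: ws; rewrite ltW.
suff small t : 0 <= t <= T -> `|w t - x| <= 1.
  move=> t tT; apply: bound => // s /andP[s0 st]; apply: small.
  by rewrite s0 (le_trans (ltW st))//; case/andP: tT.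
move=> tT; rewrite leNgt; apply/negP => t1.
pose S := [set s : R | 0 <= s <= T /\ 1 < `|w s - x|].
have St : S t by [].
have lbS : lbound S 0 by move=> s [/andP[]].
have infS : has_inf S by split; [exists t|exists 0].
pose i := inf S.
have i0 : 0 <= i by apply: lb_le_inf => //; exists t.
have iT : i <= T.
  apply: (@le_trans _ _ t); last by case/andP: tT.
  by apply: ge_inf => //; exists 0.
have wi : `|w i - x| < 1.
  apply: (@le_lt_trans _ _ (M * i)); last first.
    by apply: le_lt_trans TM; rewrite mulrC ler_wpM2r.
  apply: bound => [|s /andP[s0 si]]; first by rewrite i0.
  have sT : s <= T := ltW (lt_le_trans si iT).
  rewrite leNgt; apply/negP => s1; move: si; rewrite ltNge => /negP; apply.
  by apply: ge_inf; [exists 0|split => //; rewrite s0].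
have /subspace_continuousP/(_ i) := cw.
rewrite /= in_itv /= i0 iT => /(_ isT)/cvgrPdist_lt/(_ (1 - `|w i - x|)).
rewrite subr_gt0 => /(_ wi)/nbhs_ballP[e /= e0 near_i].
have [s [/andP[s0 sT] s1] se] := inf_adherent e0 infS.
have si : i <= s by apply: ge_inf; [exists 0|split => //; rewrite s0].
have : `|w i - w s| < 1 - `|w i - x|.
  apply: near_i; last by rewrite /= in_itv /= s0.
  by rewrite /ball /= distrC ger0_norm ?subr_ge0// ltrBlDl.
have : `|w s - x| <= `|w i - x| + `|w i - w s|.
  have -> : w s - x = (w i - x) - (w i - w s) by rewrite opprB [RHS]addrC addrA subrK.
  exact: ler_normB.
by move: s1; lra.
Qed.

End ode.

(** * Uniform error bounds *)

Section uniform_bounds.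
Context {R : realType} {Q : Type}.
Variables (D : set Q) (ep : Q -> R).
Hypothesis ep01 : forall q, D q -> 0 <= ep q <= 1.
Implicit Types (f g : Q -> R).

Definition isO (n : nat) f := exists2 C : R, 0 <= C &
  forall q, D q -> `|f q| <= C * ep q ^+ n.

Lemma isO_eq n f g : (forall q, D q -> f q = g q) -> isO n f -> isO n g.
Proof. by move=> fg [C C0 fC]; exists C => // q Dq; rewrite -fg//; exact: fC. Qed.

Lemma isO_weak n k f : (k <= n)%N -> isO n f -> isO k f.
Proof.
move=> kn [C C0 fC]; exists C => // q Dq; apply: (le_trans (fC q Dq)).
have /andP[e0 e1] := ep01 q Dq.
by rewrite ler_wpM2l// ler_wiXn2l.
Qed.

Lemma isO_cst (c : R) : isO 0 (fun=> c).
Proof. by exists `|c| => // q _; rewrite expr0 mulr1. Qed.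

Lemma isO_ep : isO 1 ep.
Proof. by exists 1 => // q Dq; rewrite expr1 mul1r ger0_norm//; case/andP: (ep01 q Dq). Qed.

Lemma isO0 n : isO n (fun=> 0).
Proof. by exists 0 => // q _; rewrite normr0 mul0r. Qed.

Lemma isOD n f g : isO n f -> isO n g -> isO n (fun q => f q + g q).
Proof.
move=> [C C0 fC] [K K0 gK]; exists (C + K); first by rewrite addr_ge0.
move=> q Dq; rewrite mulrDl; apply: (le_trans (ler_normD _ _)).
by apply: lerD; [exact: fC|exact: gK].
Qed.

Lemma isON n f : isO n f -> isO n (fun q => - f q).
Proof. by move=> [C C0 fC]; exists C => // q Dq; rewrite normrN; exact: fC. Qed.

Lemma isOB n f g : isO n f -> isO n g -> isO n (fun q => f q - g q).
Proof. by move=> fO /isON; exact: isOD. Qed.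

Lemma isOM n k f g : isO n f -> isO k g -> isO (n + k) (fun q => f q * g q).
Proof.
move=> [C C0 fC] [K K0 gK]; exists (C * K); first by rewrite mulr_ge0.
move=> q Dq; rewrite normrM exprD mulrACA; apply: ler_pM => //; [exact: fC|exact: gK].
Qed.

Lemma isOZ n (c : R) f : isO n f -> isO n (fun q => c * f q).
Proof. by move=> fO; exact: (isOM 0 _ _ _ (isO_cst c) fO). Qed.

Lemma isO_epM n f : isO n f -> isO n.+1 (fun q => ep q * f q).
Proof. exact: (isOM 1 _ _ _ isO_ep). Qed.

Lemma isO_sum n (I : Type) (r : seq I) (F : I -> Q -> R) :
  (forall i, isO n (F i)) -> isO n (fun q => \sum_(i <- r) F i q).
Proof.
move=> FO; elim: r => [|i r IH].
  by apply: isO_eq (isO0 n) => q _; rewrite big_nil.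
by apply: isO_eq (isOD _ _ _ (FO i) IH) => q _; rewrite big_cons.
Qed.

(** The index varies with the parameter but ranges over a finite type, so the sum of the constants
    serves for all parameters. This makes the bounds uniform in the orders. *)
Lemma isO_fin n (I : finType) (F : I -> Q -> R) (k : Q -> I) :
  (forall i, isO n (F i)) -> isO n (fun q => F (k q) q).
Proof.
move=> /(_ _)/cid2 H; pose C i := s2val (H i).
have C0 i : 0 <= C i by rewrite /C; case: (H i).
exists (\sum_i C i); first exact: sumr_ge0.
move=> q Dq; apply: (@le_trans _ _ (C (k q) * ep q ^+ n)).
  by rewrite /C; case: (H (k q)) => /= ? _; exact.
have /andP[e0 _] := ep01 q Dq.
by rewrite ler_wpM2r ?exprn_ge0// (bigD1 (k q))//= lerDl sumr_ge0.
Qed.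

Section rows.
Context {d : nat}.
Implicit Types (x y : Q -> 'rV[R]_d) (h : 'rV[R]_d -> R).

Local Notation partial k f := ('D_(delta_mx 0 k) f).

(** Coordinatewise, so that expansions reduce to scalar identities for [ring] and [field]. *)
Definition vO n x := forall p, isO n (fun q => x q 0 p).

Lemma vO_norm n x : vO n x -> exists2 C : R, 0 <= C &
  forall q, D q -> `|x q| <= C * ep q ^+ n.
Proof.
move=> /(_ _)/cid2 H; pose C i := s2val (H i).
have C0 i : 0 <= C i by rewrite /C; case: (H i).
exists (\sum_i C i); first exact: sumr_ge0.
move=> q Dq; have /andP[e0 _] := ep01 q Dq.
apply: row_norm_le => [|p]; first by rewrite mulr_ge0 ?exprn_ge0// sumr_ge0.
apply: (@le_trans _ _ (C p * ep q ^+ n)).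
  by rewrite /C; case: (H p) => /= ? _; exact.
by rewrite ler_wpM2r ?exprn_ge0// (bigD1 p)//= lerDl sumr_ge0.
Qed.

Lemma vO_of_norm n x (C : R) : 0 <= C -> (forall q, D q -> `|x q| <= C * ep q ^+ n) ->
  vO n x.
Proof.
move=> C0 xC p; exists C => // q /xC; apply: le_trans; exact: coord_le_norm.
Qed.

Lemma isO_bounded h x : loc_bounded h -> vO 0 x -> isO 0 (fun q => h (x q)).
Proof.
move=> hb /vO_norm[C C0 xC]; have [K K0 hK] := hb C; exists K => // q Dq.
by rewrite expr0 mulr1; apply: hK; rewrite (le_trans (xC q Dq))// expr0 mulr1.
Qed.

Lemma isO_lipschitz n h x y : loc_lipschitz h -> vO 0 x -> vO 0 y ->
  vO n (fun q => y q - x q) -> isO n (fun q => h (y q) - h (x q)).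
Proof.
move=> hl /vO_norm[C C0 xC] /vO_norm[B B0 yB] /vO_norm[A A0 yx].
have [K K0 hK] := hl (Num.max C B); exists (K * A); first by rewrite mulr_ge0.
move=> q Dq; apply: (@le_trans _ _ (K * `|y q - x q|)).
  apply: hK; rewrite le_max.
    by have := xC q Dq; rewrite expr0 mulr1 => ->.
  by have := yB q Dq; rewrite expr0 mulr1 orbC => ->.
by rewrite -mulrA ler_wpM2l// yx.
Qed.

Lemma isO_taylor h x y : smooth h -> vO 0 x -> vO 0 y ->
  vO 1 (fun q => y q - x q) ->
  isO 2 (fun q => h (y q) - h (x q) -
    \sum_k partial k h (x q) * (y q 0 k - x q 0 k)).
Proof.
move=> sh /vO_norm[C C0 xC] /vO_norm[B B0 yB] /vO_norm[A A0 yx].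
have [K K0 hK] := smooth_taylor h sh (Num.max C B).
exists (K * A ^+ 2); first by rewrite mulr_ge0// exprn_ge0.
move=> q Dq; apply: (@le_trans _ _ (K * `|y q - x q| ^+ 2)).
  apply: hK; rewrite le_max.
    by have := xC q Dq; rewrite expr0 mulr1 => ->.
  by have := yB q Dq; rewrite expr0 mulr1 orbC => ->.
rewrite -mulrA ler_wpM2l// -exprMn lerXn2r ?nnegrE//.
  by rewrite mulr_ge0//; case/andP: (ep01 q Dq).
by have := yx q Dq; rewrite expr1.
Qed.

Lemma isO_partial p h x : smooth h -> vO 0 x -> isO 0 (fun q => partial p h (x q)).
Proof. by move=> /(smooth_partial _ p)/smooth_loc_bounded; exact: isO_bounded. Qed.

Lemma isO_partialB n p h x y : smooth h -> vO 0 x -> vO 0 y ->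
  vO n (fun q => y q - x q) -> isO n (fun q => partial p h (y q) - partial p h (x q)).
Proof. by move=> /(smooth_partial _ p)/smooth_loc_lipschitz; exact: isO_lipschitz. Qed.

End rows.
End uniform_bounds.

(* Sum of M b a over the pairs in which a occurs before b in s. *)
Fixpoint sum_pairs {R : realType} {T : Type} (M : T -> T -> R) (s : seq T) : R :=
  if s is a :: s' then \sum_(b <- s') M b a + sum_pairs M s' else 0.

Section sum_pairs.
Context {R : realType} {T : Type}.
Implicit Types (M : T -> T -> R) (s : seq T).

Lemma sum_pairs_rcons M s k :
  sum_pairs M (rcons s k) = sum_pairs M s + \sum_(a <- s) M k a.
Proof.
elim: s => [|a s IH] /=; first by rewrite !big_nil addr0.
by rewrite IH -cats1 big_cat big_seq1 big_cons /=; ring.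
Qed.

Lemma sum_pairs_rev M s : sum_pairs M s + sum_pairs M (rev s) =
  \sum_(a <- s) \sum_(b <- s) M a b - \sum_(a <- s) M a a.
Proof.
elim: s => [|a s IH] /=; first by rewrite !big_nil addr0 subr0.
rewrite rev_cons sum_pairs_rcons !big_cons.
under [X in _ = _ + X - _]eq_bigr do rewrite big_cons.
rewrite big_split /=.
have -> : \sum_(b <- rev s) M a b = \sum_(b <- s) M a b.
  by elim: (s) => [|b t IHt] //; rewrite rev_cons -cats1 big_cat big_seq1 IHt big_cons addrC.
by rewrite -[sum_pairs M s](addrK (sum_pairs M (rev s))) IH; ring.
Qed.

End sum_pairs.

(** * Expansion of the local steps *)

Section descent.
Context {R : realType} {Q : Type} {d : nat} {K : Type}.
Variables (D : set Q) (ep : Q -> R).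
Hypothesis ep01 : forall q, D q -> 0 <= ep q <= 1.
Variables (F : K -> 'rV[R]_d -> R) (x b : Q -> 'rV[R]_d).
Hypothesis sF : forall k, smooth (F k).
Hypothesis x0 : vO D ep 0 x.
Hypothesis b0 : vO D ep 0 b.

Local Notation partial k f := ('D_(delta_mx 0 k) f).

(** Local steps along an arbitrary sequence, which allows induction on the last step; the control
    variates are merged into one offset [b], fixed during the round. *)
Definition descent (s : seq K) (q : Q) : 'rV[R]_d :=
  foldl (fun v k => v - ep q *: (grad (F k) v + b q)) (x q) s.

Definition drift (k : K) (p : 'I_d) (q : Q) : R := partial p (F k) (x q) + b q 0 p.

(** To first order and up to the factor [- ep q], the change that an earlier step [k'] causes in
    component [p] of the gradient used by step [k]. *)
Definition curvature (p : 'I_d) (q : Q) (k k' : K) : R :=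
  \sum_l partial l (partial p (F k)) (x q) * drift k' l q.

Let descent_rcons s k q p : descent (rcons s k) q 0 p =
  descent s q 0 p - ep q * (partial p (F k) (descent s q) + b q 0 p).
Proof. by rewrite /descent foldl_rcons !mxE. Qed.

Let drift0 k p : isO D ep 0 (drift k p).
Proof.
apply: isOD; last exact: b0.
exact: isO_partial.
Qed.

Let descent0 s : vO D ep 0 (descent s).
Proof.
elim/last_ind: s => [|s k IH] p; first exact: x0.
apply: isO_eq; first by move=> q _; rewrite descent_rcons.
apply: isOB; first exact: IH.
apply: (isO_weak _ _ ep01 1) => //; apply: isO_epM => //; apply: isOD; last exact: b0.
exact: isO_partial.
Qed.

(** The two claims feed each other: a displacement of order 1 changes the next gradient by [O(ep)],
    hence the next step by [O(ep^2)]; dropping the drift sum, itself [O(ep)] after multiplication by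
    [ep], gives back the first claim. *)
Lemma descent_first_order s p : isO D ep 1 (fun q => descent s q 0 p - x q 0 p) /\
  isO D ep 2 (fun q => descent s q 0 p - x q 0 p + ep q * \sum_(k <- s) drift k p q).
Proof.
elim/last_ind: s p => [|s k IH] p.
  by split; apply: isO_eq (isO0 _ _ _) => q _; rewrite ?big_nil /= ?mulr0 ?addr0 subrr.
have IH1 : vO D ep 1 (fun q => descent s q - x q).
  by move=> l; apply: isO_eq (IH l).1 => q _; rewrite !mxE.
have grad1 : isO D ep 1 (fun q => partial p (F k) (descent s q) - partial p (F k) (x q)).
  exact: isO_partialB.
suff H2 : isO D ep 2 (fun q => descent (rcons s k) q 0 p - x q 0 p +
    ep q * \sum_(k <- rcons s k) drift k p q).
  split=> //.
  apply: isO_eq (isOB _ _ _ _ _ (isO_weak _ _ ep01 _ _ _ (leqnSn 1) H2)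
    (isO_epM _ _ ep01 _ _ (isO_sum _ _ _ _ (rcons s k) _ (fun k => drift0 k p)))).
  by move=> q _; rewrite addrK.
apply: isO_eq (isOB _ _ _ _ _ (IH p).2 (isO_epM _ _ ep01 _ _ grad1)) => q _.
rewrite descent_rcons -cats1 big_cat big_seq1 /drift /=.
move: (\sum_(_ <- _) _) (descent s q 0 p) (partial p (F k) (descent s q)) (partial p (F k) (x q)).
by move=> *; ring.
Qed.

(** In the Taylor expansion of the last gradient, the displacement is replaced by its first-order
    value, a sum over the earlier steps. This adds exactly the pairs of [sum_pairs_rcons]. *)
Lemma descent_second_order s p : isO D ep 3 (fun q => descent s q 0 p - x q 0 p +
  ep q * \sum_(k <- s) drift k p q - ep q ^+ 2 * sum_pairs (curvature p q) s).
Proof.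
elim/last_ind: s => [|s k IH].
  by apply: isO_eq (isO0 _ _ _) => q _; rewrite big_nil /= !mulr0 addr0 subrr subr0.
have T2 : isO D ep 2 (fun q => partial p (F k) (descent s q) - partial p (F k) (x q) -
    \sum_l partial l (partial p (F k)) (x q) * (descent s q 0 l - x q 0 l)).
  apply: isO_taylor => //; first exact: smooth_partial.
  by move=> l; apply: isO_eq (descent_first_order s l).1 => q _; rewrite !mxE.
have S2 : isO D ep 2 (fun q => \sum_l partial l (partial p (F k)) (x q) *
    (descent s q 0 l - x q 0 l + ep q * \sum_(k <- s) drift k l q)).
  apply: isO_sum => l; apply: (isOM _ _ 0); last exact: (descent_first_order s l).2.
  by apply: isO_partial => //; exact: smooth_partial.
apply: isO_eq (isOB _ _ _ _ _ IH (isO_epM _ _ ep01 _ _ (isOD _ _ _ _ _ T2 S2))) => q _.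
rewrite descent_rcons -cats1 big_cat big_seq1 cats1 sum_pairs_rcons /=.
have -> : \sum_l partial l (partial p (F k)) (x q) *
    (descent s q 0 l - x q 0 l + ep q * \sum_(k <- s) drift k l q) =
  \sum_l partial l (partial p (F k)) (x q) * (descent s q 0 l - x q 0 l) +
  ep q * \sum_(a <- s) curvature p q k a.
  rewrite /curvature exchange_big mulr_sumr -big_split /=; apply: eq_bigr => l _.
  rewrite mulrDr mulrCA; congr (_ + _ * _); rewrite mulr_sumr.
  by apply: eq_bigr.
rewrite [drift k p q]/drift.
move: (\sum_(_ <- _) _) (\sum_(_ <- _) _) (\sum_l _) (sum_pairs _ _) => A1 A2 A3 A4.
move: (partial p (F k) (descent s q)) (partial p (F k) (x q)) => A5 A6.
by ring.
Qed.

End descent.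

(** * Averages over random orders *)

Section permutation_average.
Context {R : realType} {E : nat}.

Lemma sum_perm_map (f : 'I_E -> R) (s : 'S_E) :
  \sum_(k <- [seq s k | k <- enum 'I_E]) f k = \sum_k f k.
Proof. by rewrite big_map big_enum /= [RHS](reindex_inj (@perm_inj _ s)). Qed.

Lemma rev_enum_ord : rev (enum 'I_E) = [seq rev_ord k | k <- enum 'I_E].
Proof.
apply: (inj_map val_inj); rewrite map_rev val_enum_ord -map_comp.
apply: (@eq_from_nth _ 0%N) => [|i]; first by rewrite size_rev size_iota size_map size_enum_ord.
rewrite size_rev size_iota => iE.
rewrite nth_rev size_iota// nth_iota; last by rewrite subnSK// leq_subr.
rewrite (nth_map (Ordinal iE)) ?size_enum_ord// add0n.
by rewrite -[RHS]/(E - (nth (Ordinal iE) (enum 'I_E) i).+1)%N nth_enum_ord.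
Qed.

(* Reversing the order exchanges the two halves of the sum over ordered pairs. *)
Lemma sum_pairs_perm (M : 'I_E -> 'I_E -> R) :
  (E`!)%:R^-1 * \sum_(s : 'S_E) sum_pairs M [seq s k | k <- enum 'I_E] =
  2^-1 * (\sum_a \sum_b M a b - \sum_a M a a).
Proof.
pose S := \sum_(s : 'S_E) sum_pairs M [seq s k | k <- enum 'I_E].
pose rho : 'S_E := perm (@rev_ord_inj E).
have Srev : S = \sum_(s : 'S_E) sum_pairs M (rev [seq s k | k <- enum 'I_E]).
  (* [rho * s] applies [rho] first, so it lists the mini-batches of [s] backwards. *)
  rewrite /S (reindex_inj (mulgI rho)) /=; apply: eq_bigr => s _.
  rewrite -map_rev rev_enum_ord -map_comp; congr sum_pairs; apply: eq_map => k /=.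
  by rewrite permM permE.
have SS : S + S = (E`!)%:R * (\sum_a \sum_b M a b - \sum_a M a a).
  rewrite {2}Srev -big_split /=.
  rewrite (eq_bigr (fun=> \sum_a \sum_b M a b - \sum_a M a a)); last first.
    move=> s _; rewrite sum_pairs_rev !sum_perm_map; congr (_ - _).
    by apply: eq_bigr => a _; rewrite sum_perm_map.
  by rewrite sumr_const card_Sn mulr_natl.
have E0 : (E`!)%:R != 0 :> R by rewrite pnatr_eq0 -lt0n fact_gt0.
rewrite -/S (_ : S = 2^-1 * (S + S)); last by field.
by rewrite SS mulrCA mulrA mulrA; field.
Qed.

End permutation_average.

Section rounds.
Context {R : realType} {Q : Type} {d m E : nat}.
Variables (D : set Q) (ep : Q -> R).
Hypothesis ep01 : forall q, D q -> 0 <= ep q <= 1.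
Variable L : 'I_m -> 'I_E -> 'rV[R]_d -> R.
Hypothesis sL : forall j k, smooth (L j k).
Hypothesis m0 : (0 < m)%N.
Variables (cj : 'I_m -> Q -> 'rV[R]_d) (c x : Q -> 'rV[R]_d).
Hypothesis cj0 : forall j, vO D ep 0 (cj j).
Hypothesis c0 : vO D ep 0 c.
Hypothesis x0 : vO D ep 0 x.

Let b j q := - cj j q + c q.

Let b0 j : vO D ep 0 (b j).
Proof.
move=> p; apply: isO_eq (isOB _ _ _ _ _ (c0 p) (cj0 j p)) => q _.
by rewrite !mxE addrC.
Qed.

Lemma local_updateE j (s : 'S_E) q :
  local_update L (ep q) j s (cj j q) (c q) (x q) =
  descent ep (L j) x (b j) [seq s k | k <- enum 'I_E] q.
Proof.
rewrite /local_update /descent; elim: (enum 'I_E) (x q) => //= k t IH v.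
by rewrite IH /b addrA.
Qed.

(** Holds for each choice of orders rather than on average, since it has to control the actual
    iterates. *)
Lemma scaffold_round_first_order (sg : Q -> round_order m E) :
  vO D ep 1 (fun q => scaffold_round L (ep q) (sg q) (cj^~ q) (c q) (x q) - x q).
Proof.
move=> p.
have O1 j : isO D ep 1 (fun q =>
    local_update L (ep q) j (sg q j) (cj j q) (c q) (x q) 0 p - x q 0 p).
  apply: (isO_fin _ _ ep01 _ _ (fun s q =>
    local_update L (ep q) j s (cj j q) (c q) (x q) 0 p - x q 0 p) (fun q => sg q j)).
  move=> s; apply: isO_eq (descent_first_order _ _ ep01 _ _ _ (sL j) x0 (b0 j) _ p).1.
  by move=> q _; rewrite local_updateE.
apply: isO_eq (isOZ _ _ _ m%:R^-1 _ (isO_sum _ _ _ _ (index_enum 'I_m) _ O1)) => q _.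
rewrite sumrB sumr_const card_ord -(mulr_natl (x q 0 p)) mulrBr.
rewrite [_ * (m%:R * _)]mulrA mulVf ?pnatr_eq0 -?lt0n// mul1r.
by rewrite !mxE summxE.
Qed.

(** The first-order sum does not depend on the order of the steps, and [sum_pairs_perm] averages the
    pairs; the factor [2^-1] is the one found there. *)
Lemma mean_update_second_order p : isO D ep 3 (fun q =>
  m%:R^-1 * (\sum_j (E`!)%:R^-1 *
    \sum_(s : 'S_E) local_update L (ep q) j s (cj j q) (c q) (x q) 0 p)
  - x q 0 p + ep q * (m%:R^-1 * \sum_j \sum_k drift (L j) x (b j) k p q)
  - ep q ^+ 2 / 2 * (m%:R^-1 * \sum_j
     (\sum_k \sum_l curvature (L j) x (b j) p q k l
      - \sum_k curvature (L j) x (b j) p q k k))).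
Proof.
have O3 j (s : 'S_E) := descent_second_order _ _ ep01 _ _ _ (sL j) x0 (b0 j)
  [seq s k | k <- enum 'I_E] p.
have O3s j := isOZ _ _ _ (E`!)%:R^-1 _ (isO_sum _ _ _ _ (index_enum 'S_E) _ (O3 j)).
apply: isO_eq (isOZ _ _ _ m%:R^-1 _ (isO_sum _ _ _ _ (index_enum 'I_m) _ O3s)) => q _.
have E0 : (E`!)%:R != 0 :> R by rewrite pnatr_eq0 -lt0n fact_gt0.
have M0 : m%:R != 0 :> R by rewrite pnatr_eq0 -lt0n.
transitivity (m%:R^-1 * \sum_(j < m) ((E`!)%:R^-1 *
    \sum_(s : 'S_E) local_update L (ep q) j s (cj j q) (c q) (x q) 0 p - x q 0 p
    + ep q * \sum_k drift (L j) x (b j) k p q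
    - ep q ^+ 2 / 2 * (\sum_k \sum_l curvature (L j) x (b j) p q k l
      - \sum_k curvature (L j) x (b j) p q k k))).
  congr (_ * _); apply: eq_bigr => j _.
  have pairs := sum_pairs_perm (curvature (L j) x (b j) p q).
  rewrite (eq_bigr (fun s => local_update L (ep q) j s (cj j q) (c q) (x q) 0 p
    + (ep q * \sum_k drift (L j) x (b j) k p q - x q 0 p)
    - ep q ^+ 2 * sum_pairs (curvature (L j) x (b j) p q) [seq s k | k <- enum 'I_E])).
    rewrite sumrB big_split /= -mulr_sumr sumr_const card_Sn -[(_ - _) *+ E`!]mulr_natl.
    have alg (N A B X S W e : R) : N != 0 -> N^-1 * S = 2^-1 * W ->
      N^-1 * (A + N * (e * B - X) - e ^+ 2 * S) =
      N^-1 * A - X + e * B - e ^+ 2 / 2 * W.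
      move=> N0 SW; rewrite (_ : _ * (_ - _) =
        N^-1 * A + (e * B - X) - e ^+ 2 * (N^-1 * S)); last by field.
      by rewrite SW; field.
    exact: alg.
  move=> s _; rewrite local_updateE sum_perm_map; congr (_ - _).
  by rewrite -!addrA [- _ + _]addrC.
rewrite sumrB big_split /= sumrB -!mulr_sumr sumr_const card_ord -(mulr_natl (x q 0 p)).
have alg (N A B X C e : R) : N != 0 -> N^-1 * (A - N * X + e * B - e ^+ 2 / 2 * C) =
    N^-1 * A - X + e * (N^-1 * B) - e ^+ 2 / 2 * (N^-1 * C) by move=> N0; field.
exact: alg.
Qed.

End rounds.

(** * Expansion of the flow *)

Section flow_expansion.
Context {R : realType}.

Lemma is_derive_quadratic (A B t : R) :
  is_derive t 1 (fun s : R => s * A + s ^+ 2 * B) (A + 2 * t * B).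
Proof.
have D2 : is_derive t 1 ((id : R -> R) ^+ 2) (2 * t).
  by apply: is_derive_eq; rewrite -mulr_natl expr1 -[_%:A]/(2 * 1 * t * 1) !mulr1.
have -> : (fun s : R => s * A + s ^+ 2 * B) =
    A *: (id : R -> R) + B *: ((id : R -> R) ^+ 2).
  by apply/funext => s; rewrite mulrC (mulrC _ B).
have D1 : is_derive t 1 (A *: (id : R -> R)) (A *: 1) by exact: is_deriveZ.
have D3 : is_derive t 1 (B *: ((id : R -> R) ^+ 2)) (B *: (2 * t)) by exact: is_deriveZ.
have := is_deriveD D1 D3; rewrite -[A%:A]/(A * 1) mulr1 -[B *: (2 * t)]/(B * (2 * t)).
by rewrite (mulrC B).
Qed.

Context {Q : Type}.
Variables (D : set Q) (ep : Q -> R) (a : R).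
Hypothesis ep01 : forall q, D q -> 0 <= ep q <= 1.
Hypothesis a0 : 0 <= a.

Let T q := a * ep q.
(** Time joins the parameters: [t] is itself [O(ep)], so the whole trajectory is covered by the same
    calculus. *)
Let D' := [set z : Q * R | D z.1 /\ 0 <= z.2 <= T z.1].
Let ep' (z : Q * R) := ep z.1.

Let ep01' z : D' z -> 0 <= ep' z <= 1.
Proof. by move=> [/ep01]. Qed.

Let isO_lift n f : isO D ep n f -> isO D' ep' n (fun z => f z.1).
Proof. by move=> [C C0 fC]; exists C => // z [/fC]. Qed.

Let isO_final n (f : Q -> R -> R) : isO D' ep' n (fun z => f z.1 z.2) ->
  isO D ep n (fun q => f q (T q)).
Proof.
move=> [C C0 fC]; exists C => // q Dq; apply: (fC (q, T q)); split => //=.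
by rewrite lexx andbT mulr_ge0//; case/andP: (ep01 q Dq).
Qed.

Let isO_time : isO D' ep' 1 (fun z => z.2).
Proof. by exists a => // z [_ /andP[t0 tT]]; rewrite expr1 ger0_norm. Qed.

(** Integration over a time [O(ep)] gains one order. *)
Let isO_MVT n (f f' : Q -> R -> R) :
  (forall q, D q -> {within `[0, T q], continuous (f q)}) ->
  (forall q t, D q -> 0 < t < T q -> is_derive t 1 (f q) (f' q t)) ->
  isO D' ep' n (fun z => f' z.1 z.2) ->
  isO D' ep' n.+1 (fun z => f z.1 z.2 - f z.1 0).
Proof.
move=> cf df [C C0 fC]; exists (C * a); first by rewrite mulr_ge0.
move=> -[q t] [Dq /= /andP[t0 tT]]; have /andP[e0 e1] := ep01 q Dq.
apply: (@le_trans _ _ (C * ep q ^+ n * (t - 0))).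
  apply: (@MVT_bound _ (f q) (f' q)) => //.
  - apply: continuous_subspaceW (cf q Dq) => s /=; rewrite !in_itv /=.
    by move=> /andP[-> /le_trans]; apply.
  - by move=> s /andP[s0 st]; apply: df => //; rewrite s0 (lt_le_trans st).
  - move=> s /andP[s0 st]; apply: (fC (q, s)); split => //=.
    by rewrite ltW//= ltW// (lt_le_trans st).
rewrite subr0 exprSr -!mulrA ler_wpM2l// mulrCA ler_wpM2l ?exprn_ge0//.
Qed.

Context {d : nat}.
Variables (g V : 'I_d -> 'rV[R]_d -> R) (x : Q -> 'rV[R]_d) (w : Q -> R -> 'rV[R]_d).
Hypothesis sg : forall p, smooth (g p).
Hypothesis sV : forall p, smooth (V p).
Hypothesis x0 : vO D ep 0 x.
Hypothesis w0 : forall q, D q -> w q 0 = x q.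
Hypothesis w_cont : forall q, D q -> {within `[0, T q], continuous (w q)}.
Hypothesis w_flow : forall q t, D q -> 0 < t < T q ->
  is_derive t 1 (w q) (- \row_p (g p (w q t) + ep q * V p (w q t))).
Variable M : R.
Hypothesis M0 : 0 <= M.
Hypothesis w_bound : forall q t, D q -> 0 <= t <= T q -> `|w q t - x q| <= M * t.

Local Notation partial k f := ('D_(delta_mx 0 k) f).

Let X (z : Q * R) := x z.1.
Let W (z : Q * R) := w z.1 z.2.

Let X0 : vO D' ep' 0 X.
Proof. by move=> p; exact: isO_lift (x0 p). Qed.

Let WX : vO D' ep' 1 (fun z => W z - X z).
Proof.
apply: (vO_of_norm _ _ _ _ (M * a)); first by rewrite mulr_ge0.
move=> [q t] [Dq /= tT]; apply: (le_trans (w_bound _ _ Dq tT)).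
by rewrite expr1 -mulrA ler_wpM2l//; case/andP: tT.
Qed.

Let W0 : vO D' ep' 0 W.
Proof.
move=> p; apply: isO_eq (isOD _ _ _ _ _ (X0 p) (isO_weak _ _ ep01' _ 0 _ isT (WX p))) => z _.
by rewrite !mxE addrCA subrr addr0.
Qed.

Let polynomial_cont (A B : R) (S : set R) :
  {within S, continuous (fun s : R => s * A + s ^+ 2 * B)}.
Proof.
apply: continuous_subspaceT => s; apply: differentiable_continuous.
by apply/derivable1_diffP; case: (is_derive_quadratic A B s).
Qed.

(** Compares the flow with [X - t A - t^2 B]: an error in the velocity becomes an error of one order
    higher in the position. *)
Let MVT_polynomial n p (A B : Q -> R) :
  isO D' ep' n (fun z => - (g p (W z) + ep z.1 * V p (W z)) + (A z.1 + 2 * z.2 * B z.1)) ->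
  isO D' ep' n.+1 (fun z => W z 0 p - X z 0 p + (z.2 * A z.1 + z.2 ^+ 2 * B z.1)).
Proof.
move=> H.
have := @isO_MVT n (fun q t => w q t 0 p + (t * A q + t ^+ 2 * B q))
  (fun q t => - (g p (w q t) + ep q * V p (w q t)) + (A q + 2 * t * B q)).
move=> /(_ _ _ H) H1; apply: isO_eq (H1 _ _) => [z [Dz _]|q Dq|q t Dq tT].
- by rewrite w0//; ring.
- have cw := continuous_coord _ p _ (w_cont _ Dq).
  by move=> t; exact: (continuousD (cw t) (polynomial_cont (A q) (B q) _ t)).
- apply: is_deriveD; last exact: is_derive_quadratic.
  by have := is_derive_coord _ _ _ p (w_flow _ _ Dq tT); rewrite !mxE.
Qed.

Let flow_first_order p : isO D' ep' 2 (fun z => W z 0 p - X z 0 p + z.2 * g p (X z)).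
Proof.
have H : isO D' ep' 1 (fun z => - (g p (W z) + ep z.1 * V p (W z)) +
    (g p (x z.1) + 2 * z.2 * (fun=> 0) z.1)).
  have g1 : isO D' ep' 1 (fun z => g p (W z) - g p (X z)).
    by apply: isO_lipschitz => //; exact: smooth_loc_lipschitz.
  have V0 : isO D' ep' 0 (fun z => V p (W z)).
    by apply: isO_bounded => //; exact: smooth_loc_bounded.
  apply: isO_eq (isON _ _ _ _ (isOD _ _ _ _ _ g1 (isO_epM _ _ ep01' _ _ V0))) => z _.
  by rewrite /ep' /X; ring.
apply: isO_eq (MVT_polynomial _ _ (fun q => g p (x q)) (fun=> 0) H) => z _.
by rewrite mulr0 addr0.
Qed.

(** Inserting [flow_first_order] into the Taylor formula for [g p] gives the velocity up to
    [O(ep^2)], and one integration gives the claim. Since [V] carries a factor [ep], replacing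
    [V p (W z)] by [V p (X z)] is accurate enough. *)
Lemma flow_second_order p : isO D ep 3 (fun q => w q (a * ep q) 0 p - x q 0 p +
  (a * ep q * (g p (x q) + ep q * V p (x q)) -
   (a * ep q) ^+ 2 * (2^-1 * \sum_l partial l (g p) (x q) * g l (x q)))).
Proof.
have H : isO D' ep' 2 (fun z => - (g p (W z) + ep z.1 * V p (W z)) +
    ((g p (x z.1) + ep z.1 * V p (x z.1)) +
     2 * z.2 * - (2^-1 * \sum_l partial l (g p) (x z.1) * g l (x z.1)))).
  have g2 := isO_taylor _ _ ep01' _ _ _ (sg p) X0 W0 WX.
  have V1 : isO D' ep' 1 (fun z => V p (W z) - V p (X z)).
    by apply: isO_lipschitz => //; exact: smooth_loc_lipschitz.
  have S2 : isO D' ep' 2 (fun z => \sum_l partial l (g p) (X z) *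
      (W z 0 l - X z 0 l + z.2 * g l (X z))).
    apply: isO_sum => l; apply: (isOM _ _ 0); last exact: flow_first_order.
    exact: isO_partial.
  apply: isO_eq (isON _ _ _ _ (isOD _ _ _ _ _ (isOD _ _ _ _ _ g2 S2)
    (isO_epM _ _ ep01' _ _ V1))) => z _.
  have -> : \sum_l partial l (g p) (X z) * (W z 0 l - X z 0 l + z.2 * g l (X z)) =
    \sum_l partial l (g p) (X z) * (W z 0 l - X z 0 l) +
    z.2 * \sum_l partial l (g p) (X z) * g l (X z).
    rewrite mulr_sumr -big_split /=; apply: eq_bigr => l _.
    by rewrite mulrDr [_ * (z.2 * _)]mulrCA.
  rewrite -/(X z) /ep'; move: (\sum_l _) (\sum_l _) (g p (W z)) (g p (X z)) => A1 A2 A3 A4.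
  by field.
apply: isO_eq (isO_final _ (fun q t => w q t 0 p - x q 0 p + (t * (g p (x q) + ep q * V p (x q)) +
     t ^+ 2 * - (2^-1 * \sum_l partial l (g p) (x q) * g l (x q)))) (MVT_polynomial _ _
     (fun q => g p (x q) + ep q * V p (x q))
     (fun q => - (2^-1 * \sum_l partial l (g p) (x q) * g l (x q))) H)) => q _.
by rewrite mulrN.
Qed.

End flow_expansion.

(** * Conditional expectation *)

Section conditioning.
Context {R : realType} {disp : measure_display} {Omega : measurableType disp}.
Variable P : probability Omega R.

Lemma Rintegral_simple (I : finType) (a : I -> R) (B : I -> set Omega) (A : set Omega) :
  measurable A -> (forall i, measurable (B i)) ->
  \int[P]_(x in A) (\sum_i a i * \1_(B i) x) = \sum_i a i * fine (P (B i `&` A)).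
Proof.
move=> mA mB.
have int1 i : P.-integrable A (fun x => (\1_(B i) x)%:E).
  by apply: integrableS (integrable_indic P (mB i)).
have intZ i : P.-integrable A (fun x => ((a i)%:E * (\1_(B i) x)%:E)%E).
  exact: integrableZl.
rewrite /Rintegral; apply: EFin_inj; rewrite -sumEFin.
rewrite (eq_integral (fun x => (\sum_i (a i)%:E * (\1_(B i) x)%:E)%E)); last first.
  by move=> x _; rewrite -sumEFin; apply: eq_bigr => i _; rewrite EFinM.
rewrite integral_sum//.
have -> : (\sum_i \int[P]_(x in A) ((a i)%:E * (\1_(B i) x)%:E) =
    \sum_i (a i * fine (P (B i `&` A)))%:E)%E.
  apply: eq_bigr => i _; rewrite integralZl// integral_indic// EFinM fineK//.
  by apply: fin_num_measure; exact: measurableI.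
by rewrite sumEFin.
Qed.

Context {m E : nat}.
Variable pi : nat -> Omega -> round_order m E.
Hypothesis rpi : random_orders P pi.

Lemma past_event_measurable h i : measurable (past_event pi h i).
Proof.
elim: i => [|i IH].
  by rewrite (_ : past_event _ _ _ = setT)//; apply/seteqP; split.
rewrite (_ : past_event _ _ _ = past_event pi h i `&` [set x | pi i x = h i]).
  by apply: measurableI => //; exact: orders_measurable rpi _ _.
apply/seteqP; split => [x H|x [H1 H2] k].
  by split=> [k ki|]; apply: H => //; rewrite ltnS ltnW.
by rewrite ltnS leq_eqVlt => /predU1P[->//|/H1].
Qed.

Lemma order_measurable i j (s : 'S_E) : measurable [set x | pi i x j = s].
Proof.
rewrite (_ : [set x | _] =
  \bigcup_(sg in [set sg : round_order m E | sg j = s]) [set x | pi i x = sg]).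
  apply: fin_bigcup_measurable; first exact: finite_finset.
  by move=> sg _; exact: orders_measurable rpi _ _.
apply/seteqP; split=> [x xs|x [sg /= sgs xsg]]; first by exists (pi i x).
by rewrite xsg.
Qed.

Lemma past_event_independent h i j (s : 'S_E) :
  P ([set x | pi i x j = s] `&` past_event pi h i) =
  (((E`!)%:R^-1)%:E * P (past_event pi h i))%E.
Proof.
(* The past and the event of round [i] form one family of events on distinct rounds, to which
   independence applies over [iota 0 i] and over [iota 0 i.+1]. *)
pose A s k : set (round_order m E) :=
  if (k < i)%N then [set sg | sg = h k] else [set sg | sg j = s].
have Pi : P (past_event pi h i) =
    (\prod_(k <- iota 0 i) P [set x | A s k (pi k x)])%E.
  rewrite -(orders_independent rpi (A s) (iota_uniq 0 i)); congr (P _).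
  apply/seteqP; split=> x H k.
    by rewrite mem_iota add0n => /andP[_ ki]; rewrite /A ki; exact: H.
  by move=> ki; have := H k; rewrite mem_iota /A ki; exact.
have -> : [set x | pi i x j = s] `&` past_event pi h i =
    [set x | forall k, k \in iota 0 i.+1 -> A s k (pi k x)].
  apply/seteqP; split=> [x [xs H] k|x H].
    rewrite mem_iota add0n ltnS (leq_eqVlt k) => /andP[_ /predU1P[->|ki]].
      by rewrite /A ltnn.
    by rewrite /A ki; exact: H.
  split; first by have := H i; rewrite mem_iota add0n ltnSn /A ltnn; exact.
  move=> k ki; have ki1 : k \in iota 0 i.+1 by rewrite mem_iota add0n ltnS (ltnW ki).
  by have := H k ki1; rewrite /A ki.
rewrite (orders_independent rpi _ (iota_uniq 0 i.+1)) -addn1 iotaD big_cat big_seq1 /=.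
by rewrite -Pi /A add0n ltnn (orders_uniform rpi) muleC.
Qed.

(** On the past event [X] is a sum of terms that each depend on one client's order, hence a
    combination of indicators of conditional probability [1 / E!]. *)
Lemma cond_expectation_order {d : nat} h i (m0 : (0 < m)%N)
    (Y : 'I_m -> 'S_E -> 'rV[R]_d) (X : Omega -> 'rV[R]_d) p :
  (0 < P (past_event pi h i))%E ->
  (forall x, past_event pi h i x -> X x = m%:R^-1 *: \sum_j Y j (pi i x j)) ->
  cond_expectation P (past_event pi h i) X 0 p =
  m%:R^-1 * \sum_j ((E`!)%:R^-1 * \sum_(s : 'S_E) Y j s 0 p).
Proof.
move=> A0 XY; have mA := past_event_measurable h i.
have Afin : P (past_event pi h i) \is a fin_num by exact: fin_num_measure.
have fA0 : fine (P (past_event pi h i)) != 0.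
  by rewrite gt_eqF// fine_gt0// A0 ltey_eq Afin.
rewrite mxE.
rewrite (@eq_Rintegral _ _ _ P _ (fun x => \sum_(u : 'I_m * 'S_E)
    (m%:R^-1 * Y u.1 u.2 0 p) * \1_([set y | pi i y u.1 = u.2]) x)); last first.
  move=> x; rewrite inE => /XY ->; rewrite mxE summxE mulr_sumr.
  rewrite -(pair_bigA _ (fun j s => m%:R^-1 * Y j s 0 p * \1_[set y | pi i y j = s] x)) /=.
  apply: eq_bigr => j _; rewrite (bigD1 (pi i x j))//= big1 ?addr0.
    by rewrite indicE mem_set// mulr1.
  by move=> s sx; rewrite indicE memNset ?mulr0// => /= xs; rewrite xs eqxx in sx.
rewrite Rintegral_simple//; last by move=> u; exact: order_measurable.
rewrite mulr_suml mulr_sumr.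
rewrite -(pair_bigA _ (fun j s => m%:R^-1 * Y j s 0 p *
  fine (P ([set y | pi i y j = s] `&` past_event pi h i)) / fine (P (past_event pi h i)))) /=.
apply: eq_bigr => j _; rewrite !mulr_sumr; apply: eq_bigr => s _.
rewrite past_event_independent fineM// [X in X / _]mulrA mulfK// -mulrA.
by congr (_ * _); rewrite mulrC.
Qed.

End conditioning.

Section scaffold_past.
Context {R : realType} {d m E : nat}.
Variable L : 'I_m -> 'I_E -> 'rV[R]_d -> R.

Lemma scaffoldSS eta w0 (s : nat -> round_order m E) n :
  scaffold L eta w0 s n.+2 = scaffold_round L eta (s n.+1)
    (fun j => grad (client_loss L j) (scaffold L eta w0 s n))
    (grad (loss L) (scaffold L eta w0 s n)) (scaffold L eta w0 s n.+1).
Proof. exact: erefl. Qed.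

Lemma scaffold1 eta w0 (s : nat -> round_order m E) :
  scaffold L eta w0 s 1 = scaffold_round L eta (s 0%N) (fun=> 0) 0 w0.
Proof. exact: erefl. Qed.

Lemma scaffold_past eta w0 (s s' : nat -> round_order m E) i :
  (forall k, (k < i)%N -> s k = s' k) ->
  scaffold L eta w0 s i = scaffold L eta w0 s' i.
Proof.
move=> ss'; suff H n : (n <= i)%N -> scaffold L eta w0 s n = scaffold L eta w0 s' n.
  exact: (H i (leqnn i)).
(* Round [n.+1] reads both [omega^(n+1)] and, through the control variates, [omega^n], hence strong
   induction. *)
elim/ltn_ind: n; case=> [|[|n]] IH ni; first exact: erefl.
  by rewrite !scaffold1 ss'.
by rewrite !scaffoldSS (IH n.+1 (leqnn _) (ltnW ni)) (IH n (leqW _) (ltnW (ltnW ni))) ?ss'.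
Qed.

End scaffold_past.

(** * Comparison of the two expansions *)

Section mean_curvature.
Context {R : realType} {d m E : nat}.
Hypothesis m0 : (0 < m)%N.
Hypothesis E0 : (0 < E)%N.

Local Notation partial k f := ('D_(delta_mx 0 k) f).

(** The corrected gradients [g k - gb + G] sum to [E G], so all pairs give [E^2 Hb G]. The diagonal
    gives [E Hb G] plus the covariance sum of [H] and [g] over the mini-batches, from which the
    variance penalty arises. *)
Lemma client_curvature (H g : 'I_E -> R) (Hb gb G : R) :
  \sum_k H k = E%:R * Hb -> \sum_k g k = E%:R * gb ->
  \sum_k \sum_k' H k * (g k' + (- gb + G)) - \sum_k H k * (g k + (- gb + G)) =
  E%:R ^+ 2 * (Hb * G) - E%:R * (Hb * G) - \sum_k (Hb - H k) * (gb - g k).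
Proof.
move=> sH sgb.
have -> : \sum_k \sum_k' H k * (g k' + (- gb + G)) = E%:R ^+ 2 * (Hb * G).
  rewrite (eq_bigr (fun k => H k * (E%:R * G))) => [|k _].
    by rewrite -mulr_suml sH; ring.
  rewrite -mulr_sumr big_split /= sgb sumr_const card_ord -[_ *+ E]mulr_natl.
  by congr (_ * _); ring.
have -> : \sum_k H k * (g k + (- gb + G)) =
    \sum_k H k * g k + E%:R * Hb * (- gb + G).
  by rewrite -sH mulr_suml -big_split /=; apply: eq_bigr => k _; rewrite mulrDr.
have -> : \sum_k (Hb - H k) * (gb - g k) = \sum_k H k * g k - E%:R * (Hb * gb).
  rewrite (eq_bigr (fun k => Hb * gb - Hb * g k - gb * H k + H k * g k)) => [|k _]; last by ring.
  rewrite big_split /= !sumrB -!mulr_sumr sH sgb sumr_const card_ord -[_ *+ E]mulr_natl.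
  by ring.
by ring.
Qed.

(** For an arbitrary family [F], because it is applied to the first and second partial derivatives
    of the losses. *)
Lemma sum_local_losses (F : 'I_m -> 'I_E -> 'rV[R]_d -> R) j x :
  \sum_k F j k x = E%:R * client_loss F j x.
Proof. by rewrite /client_loss mulVKf// pnatr_eq0 -lt0n. Qed.

Lemma sum_client_losses (F : 'I_m -> 'I_E -> 'rV[R]_d -> R) x :
  \sum_j client_loss F j x = m%:R * loss F x.
Proof. by rewrite /loss mulVKf// pnatr_eq0 -lt0n. Qed.

Section linearity.
Variable L : 'I_m -> 'I_E -> 'rV[R]_d -> R.
Hypothesis sL : forall j k, smooth (L j k).

Lemma client_loss_partial p j :
  client_loss (fun j k => partial p (L j k)) j = partial p (client_loss L j).
Proof. exact: (etrans (client_lossE _ j) (esym (partial_client_loss _ sL j p))). Qed.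

Lemma loss_partial p : loss (fun j k => partial p (L j k)) = partial p (loss L).
Proof.
apply: (etrans (lossE _)); apply: (etrans _ (esym (partial_loss _ sL p))).
congr (_ *: _); exact: (eq_bigr _ (fun j _ => client_loss_partial p j)).
Qed.

End linearity.

Variable L : 'I_m -> 'I_E -> 'rV[R]_d -> R.
Hypothesis sL : forall j k, smooth (L j k).

Let sp p j k : smooth (partial p (L j k)).
Proof. exact: smooth_partial. Qed.

Lemma client_loss_partial2 p l j :
  client_loss (fun j k => partial l (partial p (L j k))) j =
  partial l (partial p (client_loss L j)).
Proof.
exact: (etrans (client_loss_partial _ (sp p) l j)
  (congr1 (fun f => partial l f) (client_loss_partial _ sL p j))).
Qed.

Lemma loss_partial2 p l :
  loss (fun j k => partial l (partial p (L j k))) = partial l (partial p (loss L)).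
Proof.
exact: (etrans (loss_partial _ (sp p) l)
  (congr1 (fun f => partial l f) (loss_partial _ sL p))).
Qed.

Let ideal (j : 'I_m) (x : 'rV[R]_d) : 'rV[R]_d := - grad (client_loss L j) x + grad (loss L) x.

(** [client_curvature] summed over coordinates and clients: the terms linear in [E] and the
    covariances combine to [- 2 E] times the correction. The parameter type is the space itself,
    with [id] as the position. *)
Lemma mean_curvature p x :
  m%:R^-1 * \sum_j (\sum_k \sum_k' curvature (L j) id (ideal j) p x k k'
    - \sum_k curvature (L j) id (ideal j) p x k k) =
  E%:R ^+ 2 * (\sum_l partial l (partial p (loss L)) x * partial l (loss L) x)
  - 2 * E%:R * correction L p x.
Proof.
pose H j k l := partial l (partial p (L j k)) x.
pose g j k l := partial l (L j k) x.
pose Hb j l := partial l (partial p (client_loss L j)) x.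
pose gb j l := partial l (client_loss L j) x.
pose G l := partial l (loss L) x.
have sH j l : \sum_k H j k l = E%:R * Hb j l.
  apply: (etrans (sum_local_losses (fun j k => partial l (partial p (L j k))) j x)).
  exact: (congr1 (fun f => E%:R * f x) (client_loss_partial2 p l j)).
have sg j l : \sum_k g j k l = E%:R * gb j l.
  apply: (etrans (sum_local_losses (fun j k => partial l (L j k)) j x)).
  exact: (congr1 (fun f => E%:R * f x) (client_loss_partial _ sL l j)).
have sHb l : \sum_j Hb j l = m%:R * partial l (partial p (loss L)) x.
  apply: (etrans _ (congr1 (fun f => m%:R * f x) (loss_partial2 p l))).
  rewrite -sum_client_losses; apply: eq_bigr => j _.
  exact: (congr1 (@^~ x) (esym (client_loss_partial2 p l j))).
have curvE j k k' : curvature (L j) id (ideal j) p x k k' =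
    \sum_l H j k l * (g j k' l + (- gb j l + G l)).
  by apply: eq_bigr => l _; rewrite /drift !mxE.
have perj j : \sum_k \sum_k' curvature (L j) id (ideal j) p x k k'
    - \sum_k curvature (L j) id (ideal j) p x k k =
    (E%:R ^+ 2 - E%:R) * \sum_l Hb j l * G l -
    \sum_k hess_grad (client_loss L j - L j k) p x.
  have -> : \sum_k hess_grad (client_loss L j - L j k) p x =
      \sum_l \sum_k (Hb j l - H j k l) * (gb j l - g j k l).
    rewrite exchange_big /=; apply: eq_bigr => k _; rewrite hess_gradE.
    have sc := smooth_client_loss _ sL j.
    apply: eq_bigr => l _; congr (_ * _).
      apply: (etrans (congr1 (fun f => partial l f x) (partialB _ _ p sc (sL j k)))).
      exact: (congr1 (@^~ x) (partialB _ _ l (smooth_partial _ p sc) (sp p j k))).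
    exact: (congr1 (@^~ x) (partialB _ _ l sc (sL j k))).
  have -> : \sum_k \sum_k' curvature (L j) id (ideal j) p x k k' =
      \sum_l \sum_k \sum_k' H j k l * (g j k' l + (- gb j l + G l)).
    rewrite [RHS]exchange_big /=; apply: eq_bigr => k _.
    by rewrite [RHS]exchange_big /=; apply: eq_bigr => k' _.
  have -> : \sum_k curvature (L j) id (ideal j) p x k k =
      \sum_l \sum_k H j k l * (g j k l + (- gb j l + G l)).
    by rewrite [RHS]exchange_big /=; apply: eq_bigr => k _.
  rewrite mulr_sumr -!sumrB; apply: eq_bigr => l _.
  by rewrite (client_curvature _ _ _ _ _ (sH j l) (sg j l)) mulrBl.
rewrite (eq_bigr _ (fun j _ => perj j)) sumrB -mulr_sumr.
have -> : \sum_j \sum_l Hb j l * G l =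
    m%:R * \sum_l partial l (partial p (loss L)) x * partial l (loss L) x.
  rewrite exchange_big mulr_sumr /=; apply: eq_bigr => l _.
  by rewrite -mulr_suml sHb mulrA.
have -> : correction L p x =
    2^-1 * (\sum_l partial l (partial p (loss L)) x * partial l (loss L) x) +
    (2 * m%:R * E%:R)^-1 * \sum_j \sum_k hess_grad (client_loss L j - L j k) p x.
  rewrite /correction -[LHS]/(2^-1 * hess_grad (loss L) p x + (2 * m%:R * E%:R)^-1 *
    (\sum_j \sum_k hess_grad (client_loss L j - L j k) p) x).
  rewrite hess_gradE; congr (_ + _ * _).
  by rewrite fct_sumE; apply: eq_bigr => j _; rewrite fct_sumE.
move: (\sum_l _) (\sum_j _) => A B.
by field; rewrite !pnatr_eq0 -!lt0n m0 E0.
Qed.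

End mean_curvature.

Section field_bounds.
Context {R : realType} {d : nat}.
Implicit Types F : 'I_d -> 'rV[R]_d -> R.

Lemma loc_lipschitz_fin F (r : R) : (forall p, loc_lipschitz (F p)) ->
  exists2 K : R, 0 <= K &
    forall p y z, `|y| <= r -> `|z| <= r -> `|F p z - F p y| <= K * `|z - y|.
Proof.
move=> /(_ _ r)/cid2 H; pose K i := s2val (H i).
have K0 i : 0 <= K i by rewrite /K; case: (H i).
exists (\sum_i K i); first exact: sumr_ge0.
move=> p y z yr zr; apply: (@le_trans _ _ (K p * `|z - y|)).
  by rewrite /K; case: (H p) => /= ? _; apply.
by rewrite ler_wpM2r// (bigD1 p)//= lerDl sumr_ge0.
Qed.

Lemma continuous_row F : (forall p, continuous (F p)) ->
  continuous (fun v => \row_p F p v : 'rV[R]_d).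
Proof.
move=> cF v; apply/(@cvgrPdist_le _ _ _ (nbhs v) (nbhs_filter v)) => e e0.
have H : \forall z \near v, forall p, `|F p v - F p z| <= e.
  apply: (@filter_forall _ _ (fun p z => `|F p v - F p z| <= e) (nbhs v) _) => p.
  exact: ((@cvgrPdist_le _ _ _ (nbhs v) (nbhs_filter v) (F p) (F p v)).1 (cF p v) e e0).
apply: filterS H => z Hz; apply: row_norm_le => [|p]; first exact: ltW.
by rewrite !mxE.
Qed.

End field_bounds.

(** * Uniform bounds on the iterates *)

Section scaffold_bounds.
Context {R : realType} {Q : Type} {d m E : nat}.
Variables (D : set Q) (ep : Q -> R).
Hypothesis ep01 : forall q, D q -> 0 <= ep q <= 1.
Variable L : 'I_m -> 'I_E -> 'rV[R]_d -> R.
Hypothesis sL : forall j k, smooth (L j k).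
Hypothesis m0 : (0 < m)%N.
Variables (w0 : 'rV[R]_d) (h : Q -> nat -> round_order m E).

Lemma vO_grad f (x : Q -> 'rV[R]_d) : smooth f -> vO D ep 0 x ->
  vO D ep 0 (fun q => grad f (x q)).
Proof.
move=> sf x0 p; have H := isO_partial _ _ ep01 p _ _ sf x0.
by apply: isO_eq H => q _; rewrite mxE.
Qed.

Let vO_shift (x y : Q -> 'rV[R]_d) : vO D ep 0 x ->
  vO D ep 1 (fun q => y q - x q) -> vO D ep 0 y.
Proof.
move=> x0 yx p.
apply: isO_eq (isOD _ _ _ _ _ (x0 p) (isO_weak _ _ ep01 _ 0 _ isT (yx p))) => q _.
by rewrite !mxE addrCA subrr addr0.
Qed.

(** Two successive iterates are bounded together, since a round depends on the previous one through
    its control variates; round 0, where these vanish, starts the induction. *)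
Lemma scaffold_bounds n :
  [/\ vO D ep 0 (fun q => scaffold L (ep q) w0 (h q) n),
      vO D ep 0 (fun q => scaffold L (ep q) w0 (h q) n.+1) &
      vO D ep 1 (fun q => scaffold L (ep q) w0 (h q) n.+1 - scaffold L (ep q) w0 (h q) n)].
Proof.
have vcst (v : 'rV[R]_d) : vO D ep 0 (fun=> v) by move=> p; exact: isO_cst.
elim: n => [|n [x0 y0 _]].
  have H1 : vO D ep 1 (fun q => scaffold L (ep q) w0 (h q) 1%N - w0).
    have H := scaffold_round_first_order _ _ ep01 _ sL m0 (fun _ _ => 0) (fun=> 0)
      (fun=> w0) (fun _ => vcst 0) (vcst 0) (vcst w0) (fun q => h q 0%N).

    by move=> p; apply: isO_eq (H p) => q _; rewrite scaffold1.
  split => //; [exact: vcst|exact: vO_shift (vcst w0) H1].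
have H1 := scaffold_round_first_order _ _ ep01 _ sL m0 _ _ _
  (fun j => vO_grad _ _ (smooth_client_loss _ sL j) x0)
  (vO_grad _ _ (smooth_loss _ sL) x0) y0 (fun q => h q n.+1).
split=> //; exact: vO_shift y0 H1.
Qed.

End scaffold_bounds.

(** * Mean update of one round against the flow *)

Section one_round.
Context {R : realType} {d m E : nat}.
Hypothesis m0 : (0 < m)%N.
Hypothesis E0 : (0 < E)%N.
Variable L : 'I_m -> 'I_E -> 'rV[R]_d -> R.
Hypothesis sL : forall j k, smooth (L j k).

Local Notation partial k f := ('D_(delta_mx 0 k) f).

Lemma grad_modified_loss eta v : grad (modified_loss L eta) v =
  \row_p (partial p (loss L) v + eta * correction L p v).
Proof.
apply/rowP => p; rewrite !mxE.
exact: (congr1 (@^~ v) (partial_modified_loss _ sL eta p)).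
Qed.

(** The value that [cond_expectation_order] gives to the conditional expectation of the next
    iterate. *)
Definition mean_update eta (cj : 'I_m -> 'rV[R]_d) (c x : 'rV[R]_d) : 'rV[R]_d :=
  \row_p (m%:R^-1 * \sum_j ((E`!)%:R^-1 *
    \sum_(s : 'S_E) local_update L eta j s (cj j) c x 0 p)).

Section expansion.
Context {Q : Type}.
Variables (D : set Q) (ep : Q -> R).
Hypothesis ep01 : forall q, D q -> 0 <= ep q <= 1.
Variables (y x : Q -> 'rV[R]_d) (w : Q -> R -> 'rV[R]_d) (M : R).
Hypothesis y0 : vO D ep 0 y.
Hypothesis x0 : vO D ep 0 x.
Hypothesis xy : vO D ep 1 (fun q => x q - y q).
Hypothesis w_flow : forall q, D q ->
  gradient_flow (modified_loss L (ep q)) (x q) (E%:R * ep q) (w q).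
Hypothesis M0 : 0 <= M.
Hypothesis w_bound : forall q t, D q -> 0 <= t <= E%:R * ep q -> `|w q t - x q| <= M * t.

Let cj j q := grad (client_loss L j) (y q).
Let c q := grad (loss L) (y q).
Let b j q := - cj j q + c q.
Let ideal j q := - grad (client_loss L j) (x q) + grad (loss L) (x q).

Let drift_mean p q : m%:R^-1 * \sum_j \sum_k drift (L j) x (b j) k p q =
  E%:R * partial p (loss L) (x q).
Proof.
have M1 : m%:R != 0 :> R by rewrite pnatr_eq0 -lt0n.
have bE j : b j q 0 p = - partial p (client_loss L j) (y q) + partial p (loss L) (y q).
  by rewrite !mxE.
have per j : \sum_k drift (L j) x (b j) k p q =
    E%:R * (partial p (client_loss L j) (x q) - partial p (client_loss L j) (y q) +
      partial p (loss L) (y q)).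
  rewrite /drift big_split /= sumr_const card_ord -[_ *+ E]mulr_natl bE.
  rewrite -[_ - _ + _]addrA [RHS]mulrDr.
  congr (_ + _).
  apply: (etrans (sum_local_losses E0 (fun j k => partial p (L j k)) j (x q))).
  exact: (congr1 (fun f => E%:R * f (x q)) (client_loss_partial _ sL p j)).
rewrite (eq_bigr _ (fun j _ => per j)) -mulr_sumr big_split /= sumrB sumr_const card_ord.
have sm z : \sum_j partial p (client_loss L j) z = m%:R * partial p (loss L) z.
  apply: (etrans _ (congr1 (fun f => m%:R * f z) (loss_partial _ sL p))).
  rewrite -(sum_client_losses m0); apply: eq_bigr => j _.
  exact: (congr1 (@^~ z) (esym (client_loss_partial _ sL p j))).
rewrite !sm -[_ *+ m]mulr_natl.
move: (partial p (loss L) (y q)) (partial p (loss L) (x q)) => A B.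
by field.
Qed.

(** An error [O(ep)] suffices, because the curvature enters the update with a factor [ep^2]. *)
Let curvature_ideal j p k k' :
  isO D ep 1 (fun q => curvature (L j) x (b j) p q k k' - curvature (L j) x (ideal j) p q k k').
Proof.
have yx : vO D ep 1 (fun q => y q - x q).
  by move=> l; apply: isO_eq (isON _ _ _ _ (xy l)) => q _; rewrite !mxE opprB.
have H l : isO D ep 1 (fun q => partial l (partial p (L j k)) (x q) *
    ((partial l (loss L) (y q) - partial l (loss L) (x q)) -
     (partial l (client_loss L j) (y q) - partial l (client_loss L j) (x q)))).
  apply: (isOM _ _ 0); first by apply: isO_partial => //; exact: smooth_partial.
  apply: isOB; apply: isO_partialB => //; first exact: smooth_loss.
  exact: smooth_client_loss.
apply: isO_eq (isO_sum _ _ _ _ (index_enum 'I_d) _ H) => q _.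
rewrite /curvature -sumrB; apply: eq_bigr => l _; rewrite -mulrBr; congr (_ * _).
rewrite /drift !mxE.
move: (partial l (loss L) (y q)) (partial l (loss L) (x q)) => A1 A2.
move: (partial l (client_loss L j) (y q)) (partial l (client_loss L j) (x q)) => A3 A4.
by ring.
Qed.

Let curvature_mean p : isO D ep 1 (fun q =>
  m%:R^-1 * (\sum_j (\sum_k \sum_l curvature (L j) x (b j) p q k l
      - \sum_k curvature (L j) x (b j) p q k k)) -
  (E%:R ^+ 2 * (\sum_l partial l (partial p (loss L)) (x q) * partial l (loss L) (x q))
  - 2 * E%:R * correction L p (x q))).
Proof.
have H j : isO D ep 1 (fun q =>
    \sum_k \sum_k' (curvature (L j) x (b j) p q k k' - curvature (L j) x (ideal j) p q k k')
    - \sum_k (curvature (L j) x (b j) p q k k - curvature (L j) x (ideal j) p q k k)).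
  by apply: isOB; apply: isO_sum => k; [apply: isO_sum => k'|].
apply: isO_eq (isOZ _ _ _ m%:R^-1 _ (isO_sum _ _ _ _ (index_enum 'I_m) _ H)) => q _.
rewrite -(mean_curvature m0 E0 L sL) -mulrBr -sumrB; congr (_ * _).
apply: eq_bigr => j _.
under eq_bigr do rewrite sumrB.
have alg (a1 a2 a3 a4 : R) : a1 - a2 - (a3 - a4) = a1 - a3 - (a2 - a4) by ring.
rewrite !sumrB; exact: alg.
Qed.

(** With [g] the gradient and [H] the Hessian of the loss, the update is [- E ep g + ep^2 / 2 (E^2 H
    g - 2 E correction)] and the flow moves by [- E ep (g + ep correction) + (E ep)^2 / 2 H g], both
    up to [O(ep^3)]: the two agree. *)
Lemma mean_update_flow : vO D ep 3 (fun q =>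
  mean_update (ep q) (cj^~ q) (c q) (x q) - w q (E%:R * ep q)).
Proof.
move=> p.
have cj0 j : vO D ep 0 (cj j) by apply: vO_grad => //; exact: smooth_client_loss.
have c0 : vO D ep 0 c by apply: vO_grad => //; exact: smooth_loss.
have S := mean_update_second_order _ _ ep01 L sL m0 cj c x cj0 c0 x0 p.
have F := flow_second_order _ _ E%:R ep01 (ler0n _ _)
  (fun p => partial p (loss L)) (fun p => correction L p) x w
  (fun p => smooth_partial _ p (smooth_loss _ sL)) (smooth_correction _ sL) x0.
have {}F := F _ _ _ M M0 w_bound p.
have C := isO_epM _ _ ep01 _ _ (isO_epM _ _ ep01 _ _ (curvature_mean p)).
have H := isOD _ _ _ _ _ (isOB _ _ _ _ _ S (F _ _ _)) (isOZ _ _ _ 2^-1 _ C).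
apply: isO_eq (H _ _ _) => [q _|q Dq|q Dq|q t Dq tT].
- rewrite drift_mean [in RHS]mxE [in RHS]mxE [X in _ = _ + X]mxE.
  move: (m%:R^-1 * \sum_j _) (m%:R^-1 * \sum_j _) => A1 A2.
  move: (\sum_l _) (partial p (loss L) (x q)) (correction L p (x q)) => A3 A4 A5.
  by field.
- by have [] := w_flow _ Dq.
- by have [] := w_flow _ Dq.
- have [_ _ /(_ _ tT)] := w_flow _ Dq.
  by rewrite grad_modified_loss.
Qed.

End expansion.
End one_round.

Theorem theorem3 (R : realType) (d m E : nat)
    (hd : (0 < d)%N) (hm : (0 < m)%N) (hE : (0 < E)%N)
    (L : 'I_m -> 'I_E -> 'rV[R]_d -> R)
    (L_smooth : forall j k, smooth (L j k))
    (w0 : 'rV[R]_d) (i : nat) (hi : (0 < i)%N) :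
  exists eta0 C : R, [/\ 0 < eta0, 0 < C &
    forall (disp : measure_display) (Omega : measurableType disp)
      (P : probability Omega R) (pi : nat -> Omega -> round_order m E),
    random_orders P pi ->
    forall eta : R, 0 < eta <= eta0 ->
    forall h : nat -> round_order m E, (0 < P (past_event pi h i))%E ->
      (exists w : R -> 'rV[R]_d,
         gradient_flow (modified_loss L eta) (scaffold L eta w0 h i)
           (E%:R * eta) w) /\
      (forall w : R -> 'rV[R]_d,
         gradient_flow (modified_loss L eta) (scaffold L eta w0 h i)
           (E%:R * eta) w ->
         enorm (cond_expectation P (past_event pi h i)
                  (fun x => scaffold L eta w0 (fun k => pi k x) i.+1)
                - w (E%:R * eta)) <= C * eta ^+ 3)].
Proof.
(* With [i = n.+1] the control variates of round [i] are gradients at [omega^n]. *)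
case: i hi => // n _.
(* A preliminary parameter set with [eta <= 1]: the radius [r] has to be known before [eta0] can be
   chosen. *)
pose D0 := [set q : R * (nat -> round_order m E) | 0 < q.1 <= 1].
have D001 q : D0 q -> 0 <= q.1 <= 1 by move=> /andP[/ltW -> ->].
have [_ /(vO_norm _ _ D001)[r r0 Sr] _] :=
  scaffold_bounds D0 fst D001 L L_smooth hm w0 snd n.
have {}Sr eta h : 0 < eta <= 1 -> `|scaffold L eta w0 h n.+1| <= r.
  by move=> eta1; have := Sr (eta, h) eta1; rewrite expr0 mulr1.
have sg p : smooth ('D_(delta_mx 0 p) (loss L)) := smooth_partial _ p (smooth_loss _ L_smooth).
have sV p : smooth (correction L p) := smooth_correction _ L_smooth p.
(* The ball of radius [r + 1] contains the unit ball around every possible [omega^i]. *)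
have [Mg Mg0 gM] := loc_bounded_fin _ _ (r + 1) (fun p => smooth_loc_bounded _ (sg p)).
have [MV MV0 VM] := loc_bounded_fin _ _ (r + 1) (fun p => smooth_loc_bounded _ (sV p)).
have [Kg Kg0 gK] := loc_lipschitz_fin _ (r + 1) (fun p => smooth_loc_lipschitz _ (sg p)).
have [KV KV0 VK] := loc_lipschitz_fin _ (r + 1) (fun p => smooth_loc_lipschitz _ (sV p)).
pose M := Mg + MV; pose K := Kg + KV.
have M0 : 0 <= M by rewrite addr_ge0.
have K0 : 0 <= K by rewrite addr_ge0.
pose G eta v : 'rV[R]_d := - grad (modified_loss L eta) v.
have ball1 eta h v : 0 < eta <= 1 -> `|v - scaffold L eta w0 h n.+1| <= 1 -> `|v| <= r + 1.
  move=> eta1 vx; rewrite -[v](subrK (scaffold L eta w0 h n.+1)) addrC.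
  by apply: (le_trans (ler_normD _ _)); rewrite lerD// Sr.
have GM eta v : 0 < eta <= 1 -> `|v| <= r + 1 -> `|G eta v| <= M.
  move=> /andP[e0 e1] vr; apply: row_norm_le => // p.
  rewrite /G grad_modified_loss// !mxE normrN.
  apply: (le_trans (ler_normD _ _)); rewrite lerD ?gM// normrM gtr0_norm//.
  by rewrite (le_trans (ler_piMl _ e1)) ?VM.
have GK eta v z : 0 < eta <= 1 -> `|v| <= r + 1 -> `|z| <= r + 1 ->
    `|G eta v - G eta z| <= K * `|v - z|.
  move=> /andP[e0 e1] vr zr; apply: row_norm_le => [|p]; first by rewrite mulr_ge0.
  rewrite /G !grad_modified_loss// !mxE opprK addrC -[X in `|X|]/(_ - _).
  rewrite opprD addrACA -mulrBr (distrC v) mulrDl.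
  apply: (le_trans (ler_normD _ _)); apply: lerD; first exact: gK.
  by rewrite normrM gtr0_norm// (le_trans (ler_piMl _ e1)) ?VK.
have E0 : 0 < E%:R :> R by rewrite ltr0n.
have den0 : 0 < 2 * E%:R * (M + K + 1) :> R by rewrite !mulr_gt0// ltr_wpDl// addr_ge0.
(* Chosen so that [E eta M] and [E eta K] are at most [2^-1], which serves both [picard] and
   [ode_solution_bound]; the [+ 1] keeps the denominator positive. *)
pose eta0 := Num.min 1 (2 * E%:R * (M + K + 1))^-1.
have eta0_gt0 : 0 < eta0 by rewrite lt_min ltr01 invr_gt0.
have eta0P eta : 0 < eta <= eta0 -> [/\ 0 < eta <= 1, 0 < E%:R * eta,
    E%:R * eta * M <= 2^-1 & E%:R * eta * K <= 2^-1].
  move=> /andP[e0]; rewrite le_min => /andP[e1 eM].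
  have T0 : 0 < E%:R * eta by rewrite mulr_gt0.
  have TMK : E%:R * eta * (M + K + 1) <= 2^-1.
    have : eta * (2 * E%:R * (M + K + 1)) <= 1 by rewrite -ler_pdivlMr// div1r.
    rewrite (_ : eta * _ = 2 * (E%:R * eta * (M + K + 1))); last by ring.
    by rewrite -ler_pdivlMl// mulr1.
  split => //; first by rewrite e0.
    by apply: le_trans TMK; rewrite ler_wpM2l ?(ltW T0)// -addrA lerDl addr_ge0.
  by apply: le_trans TMK; rewrite ler_wpM2l ?(ltW T0)// addrAC lerDr addr_ge0.
(* The solution is a parameter too, so one constant serves all solutions of the flow. *)
pose D := [set q : R * (nat -> round_order m E) * (R -> 'rV[R]_d) | 0 < q.1.1 <= eta0 /\
  gradient_flow (modified_loss L q.1.1) (scaffold L q.1.1 w0 q.1.2 n.+1) (E%:R * q.1.1) q.2].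
have D01 q : D q -> 0 <= q.1.1 <= 1 by move=> [/eta0P[/andP[/ltW -> ->]]].
have [y0 x0 xy] := scaffold_bounds D (fun q => q.1.1) D01 L L_smooth hm w0 (fun q => q.1.2) n.
have w_bound q t : D q -> 0 <= t <= E%:R * q.1.1 ->
    `|q.2 t - scaffold L q.1.1 w0 q.1.2 n.+1| <= M * t.
  move=> [/eta0P[e1 T0 TM _] [w00 wc wd]].
  have Gx v : `|v - scaffold L q.1.1 w0 q.1.2 n.+1| <= 1 -> `|G q.1.1 v| <= M.
    by move=> vx; exact: GM e1 (ball1 _ _ _ e1 vx).
  have TM1 : E%:R * q.1.1 * M < 1 by rewrite (le_lt_trans TM)// invf_lt1// ltr1n.
  exact: (ode_solution_bound (G q.1.1) _ M _ q.2 M0 Gx TM1 w00 wc wd t).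
have [C C0 HC] := vO_norm _ _ D01 _ _ (mean_update_flow hm hE L L_smooth D _ D01 _ _ _ M y0 x0 xy
  (fun q Dq => Dq.2) M0 w_bound).
(* The factor [d] comes from [enorm_le]; adding 1 makes the constant positive. *)
exists eta0, (d%:R * C + 1); split => //; first by rewrite ltr_wpDl// mulr_ge0.
move=> disp Omega P pi rpi eta eta1 h Ph; have [e1 T0 TM TK] := eta0P eta eta1.
split.
  have cG : continuous (G eta).
    have -> : G eta = fun v => \row_p
        (- ('D_(delta_mx 0 p) (loss L) v + eta * correction L p v)).
      by apply/funext => v; apply/rowP => p; rewrite /G grad_modified_loss// !mxE.
    apply: (@continuous_row _ _ (fun p => - ('D_(delta_mx 0 p) (loss L) + eta *: correction L p))).
    move=> p; apply: smooth_continuous; rewrite -scaleN1r; apply: smoothZ.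
    exact: (smoothD _ _ (sg p) (smoothZ eta _ (sV p))).
  have Gx v : `|v - scaffold L eta w0 h n.+1| <= 1 -> `|G eta v| <= M.
    by move=> vx; exact: GM e1 (ball1 _ _ _ e1 vx).
  have Glip v z : `|v - scaffold L eta w0 h n.+1| <= 1 ->
      `|z - scaffold L eta w0 h n.+1| <= 1 -> `|G eta v - G eta z| <= K * `|v - z|.
    by move=> vx zx; exact: GK e1 (ball1 _ _ _ e1 vx) (ball1 _ _ _ e1 zx).
  have TM1 : E%:R * eta * M <= 1 by rewrite (le_trans TM)// invf_le1// ler1n.
  have [w [w00 wc wd]] := picard (G eta) _ K M _ T0 cG Gx Glip TM1 TK.
  by exists w; split; [exact: w00|exact: continuous_subspaceT|exact: wd].
move=> w flow; have := HC ((eta, h), w) (conj eta1 flow).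
pose Y j s := local_update L eta j s (grad (client_loss L j) (scaffold L eta w0 h n))
  (grad (loss L) (scaffold L eta w0 h n)) (scaffold L eta w0 h n.+1).
have XY x : past_event pi h n.+1 x ->
    scaffold L eta w0 (fun k => pi k x) n.+2 = m%:R^-1 *: \sum_j Y j (pi n.+1 x j).
  move=> xh; rewrite scaffoldSS.
  rewrite (scaffold_past L eta w0 (fun k => pi k x) h n.+1 xh).
  by rewrite (scaffold_past L eta w0 (fun k => pi k x) h n (fun k kn => xh k (ltnW kn))).
have -> : cond_expectation P (past_event pi h n.+1)
    (fun x => scaffold L eta w0 (fun k => pi k x) n.+2) =
    mean_update L eta (fun j => grad (client_loss L j) (scaffold L eta w0 h n))
      (grad (loss L) (scaffold L eta w0 h n)) (scaffold L eta w0 h n.+1).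
  apply/rowP => p; rewrite [RHS]mxE.
  exact: (cond_expectation_order P _ rpi h n.+1 hm Y _ p Ph XY).
move=> /= bound; apply: (@le_trans _ _ (d%:R * (C * eta ^+ 3))).
  apply: enorm_le => [|p]; first by rewrite mulr_ge0// exprn_ge0//; case/andP: eta1 => /ltW.
  by apply: le_trans bound; exact: coord_le_norm.
rewrite mulrA ler_wpM2r//; last by rewrite lerDl.
by rewrite exprn_ge0//; case/andP: eta1 => /ltW.
Qed.
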